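(* Let $\{h_1,\dots,h_k\}$ be an orthonormal set of bounded functions in $L^2[0,1]$. Then for all $1\le i\le k$, as $N\to\infty$, $$\frac{e_i'W^2e_i-\mathbb E(e_i'W^2e_i)}{\sqrt N}\Rightarrow N(0,\sigma_2^2),\qquad \sigma_2^2=2\int_{(x,y,z)\in[0,1]^3}h_i^2(x)f(x,y)f(y,z)h_i^2(z)\,dx\,dy\,dz.$$
   Context: Fix an integer $k\ge1$, a constant $B>0$, and a bounded Riemann-integrable function $f:[0,1]^2\to[0,\infty)$. For each $N$, $W=W_N$ is the $N\times N$ random symmetric matrix $W_N(j,\ell)=X_{j\wedge\ell,\,j\vee\ell}$, where $\{X_{j,\ell}:1\le j\le\ell\le N\}$ are independent (not necessarily identically distributed) random variables with mean $0$, variance $f(j/N,\ell/N)$, and $\mathbb E|X_{j,\ell}|^m\le m^{Bm}$ for all $m\ge1$. The vectors $e_1,\dots,e_k$ are deterministic unit vectors in $\mathbb R^N$ obtained by discretizing the functions $h_1,\dots,h_k$ on $[0,1]$: the $\ell$-th entry of the column vector $e_i$ is $h_i(\ell/N)/\sqrt N$. (The orthonormality assumption on the $h_i$ is regarded as equivalent to asymptotic orthonormality of the $e_i$, that is, $e_i'e_j=\langle h_i,h_j\rangle_{L^2[0,1]}+o(1)$.) Prime denotes transpose, and $\Rightarrow$ is convergence in distribution.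
   Formalization: The formal theorem additionally assumes that f is symmetric, f(x,y)=f(y,x) on [0,1]^2, and that each h_i is Riemann integrable on [0,1]; without either assumption the stated formula for the limiting variance can fail. *)

(* Defs.v *)
From mathcomp Require Export all_boot all_order all_algebra.
From mathcomp Require Export all_classical all_reals all_analysis.
Export Order.TTheory GRing.Theory Num.Theory.
Export numFieldNormedType.Exports.

Set Implicit Arguments.
Unset Strict Implicit.
Unset Printing Implicit Defensive.

Local Open Scope classical_set_scope.
Local Open Scope ring_scope.

(* Points x 0 <= ... <= x n subdividing [0, 1] with mesh < delta; the values of
   x beyond n are irrelevant. *)
Definition subdivision (R : realType) (delta : R) (n : nat) (x : nat -> R) :=
  [/\ x 0%N = 0, x n = 1 &
    forall i, (i < n)%N -> x i <= x i.+1 /\ x i.+1 - x i < delta].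

Definition riemann_integrable (R : realType) (h : R -> R) :=
  exists I : R, forall eps, 0 < eps -> exists2 delta, 0 < delta &
    forall (n : nat) (x t : nat -> R), subdivision delta n x ->
      (forall i, (i < n)%N -> x i <= t i <= x i.+1) ->
      `|\sum_(i < n) h (t i) * (x i.+1 - x i) - I| < eps.

(* (s i j, t i j) is the tag of the cell [x i, x i.+1] * [y j, y j.+1]; it may
   depend on both indices. *)
Definition riemann_integrable2 (R : realType) (f : R -> R -> R) :=
  exists I : R, forall eps, 0 < eps -> exists2 delta, 0 < delta &
    forall (m n : nat) (x y : nat -> R) (s t : nat -> nat -> R),
      subdivision delta m x -> subdivision delta n y ->
      (forall i j, (i < m)%N -> (j < n)%N ->
        x i <= s i j <= x i.+1 /\ y j <= t i j <= y j.+1) ->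
      `|\sum_(i < m) \sum_(j < n)
          f (s i j) (t i j) * ((x i.+1 - x i) * (y j.+1 - y j)) - I| < eps.

(* Mutual independence of the subfamily of X indexed by D. *)
Definition independent_on d (T : measurableType d) (R : realType)
    (P : probability T R) (I : finType) (D : pred I) (X : I -> T -> R) :=
  forall (J : {set I}) (A : I -> set R), J \subset D ->
    (forall i, i \in J -> measurable (A i)) ->
    P (\bigcap_(i in [set` J]) (X i @^-1` A i)) =
    (\prod_(i in J) P (X i @^-1` A i))%E.

(* The normal law of mean m and variance v >= 0. The library's normal_prob takes
   the standard deviation and, when it is 0, is the uniform law on [0, 1]; the
   degenerate normal law is the point mass at m. *)
Definition normal_law (R : realType) (m v : R) :
  probability (measurableTypeR R) R :=
  if v == 0 then (dirac (m : measurableTypeR R) : probability _ _)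
  else (normal_prob m (Num.sqrt v) : probability _ _).

Definition cvg_in_distribution (R : realType) (d : nat -> measure_display)
    (T : forall N, measurableType (d N)) (P : forall N, probability (T N) R)
    (Y : forall N, T N -> R) (nu : probability (measurableTypeR R) R) :=
  forall phi : R -> R, continuous phi ->
    (exists M : R, forall x, `|phi x| <= M) ->
    ('E_(P N)[phi \o Y N])%E @[N --> \oo] --> (\int[nu]_x (phi x)%:E)%E.

(* The 0-based index j : 'I_N stands for j + 1 in {1, ..., N}. *)
Definition grid_pt (R : realType) (N : nat) (j : 'I_N) : R := j.+1%:R / N%:R.

Definition symm_mx (R : realType) (T : Type) (N : nat)
    (X : 'I_N -> 'I_N -> T -> R) (w : T) : 'M[R]_N :=
  \matrix_(j, l) X (Order.min j l) (Order.max j l) w.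

Definition discr_vec (R : realType) (N : nat) (h : R -> R) : 'cV[R]_N :=
  \col_l (h (grid_pt R l) / Num.sqrt N%:R).

Definition quad_form2 (R : realType) (N : nat) (e : 'cV[R]_N) (W : 'M[R]_N) : R :=
  (e^T *m (W *m W) *m e) 0 0.

(* The integral below and the one in orthonormal01 are Lebesgue integrals of
   functions that need not be Borel measurable. For Riemann-integrable f and h
   they nevertheless equal the Riemann integrals: the library integrates a
   nonnegative function by the supremum over simple functions below it. *)
Definition sigma2 (R : realType) (f : R -> R -> R) (h : R -> R) : R :=
  let mu := @lebesgue_measure R in
  2 * \int[((mu \x mu) \x mu)%E]_(p in (`[0, 1] `*` `[0, 1]) `*` `[0, 1])
        (h p.1.1 ^+ 2 * f p.1.1 p.1.2 * f p.1.2 p.2 * h p.2 ^+ 2).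

Definition orthonormal01 (R : realType) (k : nat) (h : 'I_k -> R -> R) :=
  forall i j, \int[@lebesgue_measure R]_(x in `[0, 1]) (h i x * h j x) =
    (i == j)%:R.

(* Main.v *)
From HB Require Import structures.
Require Import Defs.
From mathcomp Require Import ring lra measurable_realfun.

(** Indexing the independent entries by the edges [a = {j, l}], the normalized
    statistic is a quadratic form [\sum_(a, b) K a b * (X a * X b - E (X a * X b))],
    where [K a b] has order [N ^ (-3/2)] and vanishes unless the edges [a] and [b]
    meet. Its diagonal part is negligible in mean square. For the off-diagonal part
    [Z = 2^-1 * \sum_a X a * D a], where [D a] does not involve [X a], expanding [F] to
    first order around [Z - X a * D a] gives Stein's identity
    [E (Z * F Z) = E (F' Z * (2^-1 * \sum_a v a * D a ^ 2)) + o(1)]; the inner sum is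
    again a quadratic form plus its mean, and the mean converges to the limiting
    variance. It suffices to test convergence in distribution on continuous
    functions [psi] with compact support and Gaussian mean 0, and for these Stein's
    equation [s ^ 2 * F' x - x * F x = psi x] has a compactly supported solution, so no
    tail estimate for Gaussian integrals is needed. *)

(** Edges are the natural index set because [W] is symmetric: the entries [(j, l)] and [(l, j)] are
    one variable, so only unordered pairs, loops included, carry an independent family. There are at
    most [N ^ 2] edges and each meets at most [2 * N], so a row of [K] sums to order [N ^ (-1/2)];
    every error is a product of the number of edges, a bound on entries and a bound on row sums.
    Since test functions are merely continuous, the derivative of [F] is only uniformly continuous.
    A modulus [eps + C * u ^ 2] with [eps] arbitrary makes the Taylor remainder cost second and
    fourth moments only: the [eps] part meets a bounded factor, the [C] part one that tends to 0.
    The limiting variance comes from [\sum_(j, j') overlap j j' ^ 2] over pairs of vertices.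
    Distinct vertices share a single edge, so after scaling the terms with [j != j'] have order
    [1 / N], while those with [j = j'] form a Riemann sum of the triple integral, the common vertex
    being the middle variable. *)

Set Implicit Arguments.
Unset Strict Implicit.
Unset Printing Implicit Defensive.

Local Open Scope classical_set_scope.
Local Open Scope ring_scope.

(** * Random variables with moments of all orders *)

Section AllMoments.
Context d (T : measurableType d) (R : realType) (P : probability T R).
Implicit Types f g : T -> R.

(** This class is closed under sums and products, so every integrability side condition of linearity
    of the mean reduces to membership, which [moments] settles from the shape of the expression. *)
Definition all_moments g :=
  measurable_fun setT g /\
  forall m, P.-integrable setT (fun w => (`|g w| ^+ m)%:E).

Lemma integrable_dominated f g : measurable_fun setT f ->
  P.-integrable setT (EFin \o g) -> (forall w, `|f w| <= g w) ->
  P.-integrable setT (EFin \o f).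
Proof.
move=> mf ig fg; apply: le_integrable ig => //; first exact/measurable_EFinP.
by move=> w _ /=; rewrite lee_fin (le_trans (fg w))// ler_norm.
Qed.

Lemma all_moments_integrable g : all_moments g -> P.-integrable setT (EFin \o g).
Proof.
move=> [mg /(_ 1%N) ig]; apply: (integrable_dominated mg ig) => w.
by rewrite expr1.
Qed.

Lemma all_moments_le f g : measurable_fun setT f -> all_moments g ->
  (forall w, `|f w| <= `|g w|) -> all_moments f.
Proof.
move=> mf [mg ig] fg; split=> // m; apply: (integrable_dominated _ (ig m)).
  by apply: measurable_funX; exact: measurableT_comp.
by move=> w; rewrite normrX normr_id lerXn2r// nnegrE.
Qed.

Lemma all_moments_cst c : all_moments (cst c).
Proof. by split=> // m; exact: (finite_measure_integrable_cst P (`|c| ^+ m)). Qed.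

Lemma all_moments_bounded g M : measurable_fun setT g ->
  (forall w, `|g w| <= M) -> all_moments g.
Proof.
move=> mg gM; apply: (all_moments_le mg (all_moments_cst M)) => w.
by rewrite (le_trans (gM w))// ler_norm.
Qed.

(** Pointwise [|f + g| ^ m <= (2 * max) ^ m <= 2 ^ m * (|f| ^ m + |g| ^ m)], with [max] the larger
    of [|f|] and [|g|]. *)
Lemma all_momentsD f g : all_moments f -> all_moments g ->
  all_moments (fun w => f w + g w).
Proof.
move=> [mf If] [mg Ig].
have mfg : measurable_fun setT (fun w => f w + g w) by exact: measurable_funD.
split=> // m.
have Ih : P.-integrable setT
    (EFin \o (fun w => 2 ^+ m * (`|f w| ^+ m + `|g w| ^+ m))).
  exact: (eq_integrable measurableT _ _ _ (integrableZl measurableT (2 ^+ m) (integrableD measurableT (If m) (Ig m)))).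
apply: (integrable_dominated _ Ih) => [|w].
  by apply: measurable_funX; exact: measurableT_comp.
rewrite normrX normr_id.
have [fg|/ltW gf] := leP `|f w| `|g w|.
- apply: (@le_trans _ _ ((2 * `|g w|) ^+ m)).
    rewrite lerXn2r ?nnegrE// ?mulr_ge0//.
    by rewrite (le_trans (ler_normD _ _))// mulr_natl mulr2n lerD.
  by rewrite exprMn ler_wpM2l// ?exprn_ge0// lerDr exprn_ge0.
- apply: (@le_trans _ _ ((2 * `|f w|) ^+ m)).
    rewrite lerXn2r ?nnegrE// ?mulr_ge0//.
    by rewrite (le_trans (ler_normD _ _))// mulr_natl mulr2n lerD.
  by rewrite exprMn ler_wpM2l// ?exprn_ge0// lerDl exprn_ge0.
Qed.

(** Pointwise [|f * g| ^ m <= |f| ^ (2 * m) + |g| ^ (2 * m)]. *)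
Lemma all_momentsM f g : all_moments f -> all_moments g ->
  all_moments (fun w => f w * g w).
Proof.
move=> [mf If] [mg Ig].
have mfg : measurable_fun setT (fun w => f w * g w) by exact: measurable_funM.
split=> // m.
have Ih : P.-integrable setT
    (EFin \o (fun w => `|f w| ^+ (m * 2) + `|g w| ^+ (m * 2))).
  exact: (eq_integrable measurableT _ _ _ (integrableD measurableT (If (m * 2)%N) (Ig (m * 2)%N))).
apply: (integrable_dominated _ Ih) => [|w].
  by apply: measurable_funX; exact: measurableT_comp.
rewrite normrX normr_id normrM exprMn !exprM.
have := sqr_ge0 (`|f w| ^+ m - `|g w| ^+ m).
have := sqr_ge0 (`|f w| ^+ m + `|g w| ^+ m).
nra.
Qed.

Lemma all_momentsZ c f : all_moments f -> all_moments (fun w => c * f w).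
Proof. exact/all_momentsM/all_moments_cst. Qed.

Lemma all_momentsB f g : all_moments f -> all_moments g ->
  all_moments (fun w => f w - g w).
Proof.
move=> af ag; rewrite (_ : (fun _ => _) = (fun w => f w + -1 * g w)); last first.
  by apply/funext => w; rewrite mulN1r.
by apply: all_momentsD => //; exact: all_momentsZ.
Qed.

Lemma all_momentsX f n : all_moments f -> all_moments (fun w => f w ^+ n).
Proof.
move=> af; elim: n => [|n IH]; first exact: all_moments_cst.
rewrite (_ : (fun _ => _) = (fun w => f w * f w ^+ n)); last first.
  by apply/funext => w; rewrite exprS.
exact: all_momentsM.
Qed.

Lemma all_moments_norm f : all_moments f -> all_moments (fun w => `|f w|).
Proof.
move=> af; apply: (all_moments_le _ af) => [|w]; last by rewrite normr_id.
by apply: measurableT_comp => //; case: af.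
Qed.

Lemma all_moments_sum (I : Type) (s : seq I) (p : pred I) (F : I -> T -> R) :
  (forall i, p i -> all_moments (F i)) -> all_moments (fun w => \sum_(i <- s | p i) F i w).
Proof.
move=> aF; elim: s => [|i s IH].
  rewrite (_ : (fun _ => _) = cst 0); first exact: all_moments_cst.
  by apply/funext => w; rewrite big_nil.
rewrite (_ : (fun _ => _) = fun w => (if p i then F i w else 0) +
    \sum_(j <- s | p j) F j w).
  apply: all_momentsD IH.
  by case: (boolP (p i)) => [pi|_]; [exact: aF|exact: all_moments_cst].
by apply/funext => w; rewrite big_cons; case: ifP; rewrite ?add0r.
Qed.

Local Notation E g := (Rintegral P setT g).

Lemma meanD f g : all_moments f -> all_moments g ->
  E (fun w => f w + g w) = E f + E g.
Proof. by move=> af ag; rewrite RintegralD//; exact: all_moments_integrable. Qed.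

Lemma meanB f g : all_moments f -> all_moments g ->
  E (fun w => f w - g w) = E f - E g.
Proof. by move=> af ag; rewrite RintegralB//; exact: all_moments_integrable. Qed.

Lemma meanZ c f : all_moments f -> E (fun w => c * f w) = c * E f.
Proof. by move=> af; rewrite RintegralZl//; exact: all_moments_integrable. Qed.

Lemma mean_cst c : E (fun=> c) = c.
Proof. by rewrite Rintegral_cst//= probability_setT mulr1. Qed.

Lemma mean_ge0 f : (forall w, 0 <= f w) -> 0 <= E f.
Proof. by move=> f0; exact: Rintegral_ge0. Qed.

Lemma mean_le f g : all_moments f -> all_moments g ->
  (forall w, f w <= g w) -> E f <= E g.
Proof. by move=> af ag fg; apply: le_Rintegral => //; exact: all_moments_integrable. Qed.

Lemma mean_sum (I : Type) (s : seq I) (p : pred I) (F : I -> T -> R) :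
  (forall i, p i -> all_moments (F i)) ->
  E (fun w => \sum_(i <- s | p i) F i w) = \sum_(i <- s | p i) E (F i).
Proof.
move=> aF; elim: s => [|i s IH].
  by rewrite big_nil -[RHS](mean_cst 0); apply: eq_Rintegral => w _; rewrite big_nil.
rewrite big_cons -IH; case: ifPn => pi; last first.
  by apply: eq_Rintegral => w _; rewrite big_cons (negbTE pi).
rewrite -meanD; [|exact: aF|exact: all_moments_sum].
by apply: eq_Rintegral => w _; rewrite big_cons pi.
Qed.

Lemma norm_mean_le f g : all_moments f -> all_moments g ->
  (forall w, `|f w| <= g w) -> `|E f| <= E g.
Proof.
move=> af ag fg; apply: (le_trans (le_normr_Rintegral _ (all_moments_integrable af))) => //.
by apply: mean_le => //; exact: all_moments_norm.
Qed.

End AllMoments.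

(** * Functions of independent variables *)

Section MeanOfIndependentProduct.
Context d (T : measurableType d) (R : realType) (P : probability T R).
Context d1 d2 (T1 : measurableType d1) (T2 : measurableType d2).
Variables (U : {RV P >-> T1}) (V : {RV P >-> T2}).
Hypothesis UV : forall A B, measurable A -> measurable B ->
  P (U @^-1` A `&` V @^-1` B) = (P (U @^-1` A) * P (V @^-1` B))%E.

Let W : T -> T1 * T2 := fun w => (U w, V w).

Let mW : measurable_fun setT W.
Proof. exact: measurable_fun_pair. Qed.

HB.instance Definition _ := isMeasurableFun.Build _ _ _ _ W mW.

Let distribution_pair X : measurable X ->
  (distribution P U \x distribution P V)%E X = distribution P W X.
Proof. by apply: product_measure_unique => A B mA mB; exact: UV. Qed.

(** The law of the pair is the product of the two laws because they agree on rectangles; Fubini then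
    splits the integral. The target spaces are arbitrary so that [V] may be the identity of [T] onto
    a smaller sigma-algebra. *)
Lemma mean_mul_independent (f : T1 -> R) (g : T2 -> R) :
  measurable_fun setT f -> measurable_fun setT g ->
  P.-integrable setT (EFin \o (fun w => f (U w))) ->
  P.-integrable setT (EFin \o (fun w => g (V w))) ->
  P.-integrable setT (EFin \o (fun w => f (U w) * g (V w))) ->
  \int[P]_w (f (U w) * g (V w)) =
  \int[P]_w f (U w) * \int[P]_w g (V w).
Proof.
move=> mf mg If Ig Ifg.
pose k (z : T1 * T2) := (f z.1 * g z.2)%:E.
have mk : measurable_fun setT k.
  apply/measurable_EFinP; apply: measurable_funM.
    exact: measurableT_comp.
  exact: measurableT_comp.
have Ik : (distribution P U \x distribution P V)%E.-integrable setT k.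
  have /integrableP[_ Ik] : (distribution P W).-integrable setT k.
    by apply: (@integrable_pushforward _ _ _ _ _ W) => //; exact: mW.
  apply/integrableP; split => //.
  by rewrite (eq_measure_integral (distribution P W))// => A mA _; exact: distribution_pair.
have IU : (distribution P U).-integrable setT (EFin \o f).
  apply: (@integrable_pushforward _ _ _ _ _ U) => //; exact/measurable_EFinP.
have IV : (distribution P V).-integrable setT (EFin \o g).
  apply: (@integrable_pushforward _ _ _ _ _ V) => //; exact/measurable_EFinP.
have EU : \int[P]_w f (U w) = \int[distribution P U]_x f x.
  by rewrite /Rintegral (integral_distribution _ If)//; exact/measurable_EFinP.
have EV : \int[P]_w g (V w) = \int[distribution P V]_x g x.
  by rewrite /Rintegral (integral_distribution _ Ig)//; exact/measurable_EFinP.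
rewrite EU EV; apply/EFin_inj.
have -> : (\int[P]_w (f (U w) * g (V w)))%:E = (\int[P]_w (k \o W) w)%E.
  by rewrite /Rintegral fineK//; exact: integrable_fin_num.
rewrite -(@integral_distribution _ _ _ _ _ P W k)//.
rewrite [LHS](eq_measure_integral (distribution P U \x distribution P V)%E); last first.
  by move=> A mA _; apply/esym; exact: distribution_pair.
rewrite -(integral12_prod_meas1 Ik).
under eq_integral => x _.
  have -> : (fubini_F (distribution P V) k x = (f x)%:E * (\int[distribution P V]_y g y)%:E)%E.
    rewrite /fubini_F /Rintegral fineK; last exact: integrable_fin_num.
    rewrite -(integralZl _ IV)//.
  over.
rewrite (integralZr _ IU)//.
by rewrite -[X in (X * _)%E]fineK ?EFinM//; exact: integrable_fin_num.
Qed.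

End MeanOfIndependentProduct.

Section FreeOf.
Context d (T : measurableType d) (R : realType) (P : probability T R).
Variables (I : finType) (X : I -> {RV P >-> R}).

(** A pi-system that generates the sigma-algebra of the [X b] with [b != a]; one set per coordinate,
    possibly [setT], makes its stability under intersection immediate. *)
Definition other_cylinders (a : I) : set (set T) :=
  [set A | exists2 C : I -> set R, (forall i, measurable (C i)) &
    A = \bigcap_(i in [set i | i != a]) X i @^-1` C i].

(* [g] is a measurable function of the [X b] with [b != a]. *)
Definition free_of (a : I) (g : T -> R) :=
  measurable_fun [set: g_sigma_algebraType (other_cylinders a)]
    (g : g_sigma_algebraType (other_cylinders a) -> R).

Lemma other_cylinders_setI_closed a : setI_closed (other_cylinders a).
Proof.
move=> _ _ [C mC ->] [D mD ->]; exists (fun i => C i `&` D i).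
  by move=> i; exact: measurableI.
by rewrite -bigcapI; apply: eq_bigcapr => i _; rewrite preimage_setI.
Qed.

Lemma other_cylinders_measurable a : other_cylinders a `<=` measurable.
Proof.
move=> _ [C mC ->]; apply: fin_bigcap_measurable; first exact: finite_finset.
by move=> i _; rewrite -[X in measurable X]setTI; exact: measurable_funP.
Qed.

Lemma other_cylinders_setT a : other_cylinders a setT.
Proof. by exists (fun=> setT) => //; rewrite bigcapT. Qed.

Lemma g_sigma_other_measurable a : <<s other_cylinders a >> `<=` measurable.
Proof.
apply: smallest_sub; first exact: sigma_algebra_measurable.
exact: other_cylinders_measurable.
Qed.

Section Closure.
Variable a : I.

Lemma free_ofX b : b != a -> free_of a (X b).
Proof.
move=> ba _ Y mY; rewrite setTI; apply: sub_sigma_algebra.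
exists (fun i => if i == b then Y else setT) => [i|]; first by case: ifP.
rewrite eqEsubset; split=> [w Xw i _|w /(_ b ba)]; last by rewrite /= eqxx.
by rewrite /preimage /=; case: ifPn => // /eqP ->.
Qed.

Lemma free_of_cst c : free_of a (cst c).
Proof. exact: measurable_cst. Qed.

Lemma free_ofD f g : free_of a f -> free_of a g -> free_of a (fun w => f w + g w).
Proof. exact: measurable_funD. Qed.

Lemma free_ofM f g : free_of a f -> free_of a g -> free_of a (fun w => f w * g w).
Proof. exact: measurable_funM. Qed.

Lemma free_of_exp f n : free_of a f -> free_of a (fun w => f w ^+ n).
Proof. exact: measurable_funX. Qed.

Lemma free_of_comp (u : R -> R) f : measurable_fun setT u -> free_of a f ->
  free_of a (fun w => u (f w)).
Proof. by move=> mu mf; exact: measurableT_comp. Qed.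

Lemma free_of_sum (J : Type) (s : seq J) (p : pred J) (F : J -> T -> R) :
  (forall i, p i -> free_of a (F i)) ->
  free_of a (fun w => \sum_(i <- s | p i) F i w).
Proof.
move=> aF; rewrite (_ : (fun _ => _) =
    fun w => \sum_(i <- s) (if p i then F i w else 0)).
  by apply: measurable_sum => i; case: (boolP (p i)) => [/aF|_] //; exact: measurable_cst.
by apply/funext => w; rewrite big_mkcond.
Qed.

End Closure.

Hypothesis X_indep : independent_on P predT X.

(** Mutual independence is applied twice, to all indices with [B] placed at [a] and to all indices
    but [a]; the two products differ by the factor of [a]. *)
Let cylinder_indep a (C : I -> set R) (B : set R) :
  (forall i, measurable (C i)) -> measurable B ->
  P (X a @^-1` B `&` \bigcap_(i in [set i | i != a]) X i @^-1` C i) =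
  (P (X a @^-1` B) * P (\bigcap_(i in [set i | i != a]) X i @^-1` C i))%E.
Proof.
move=> mC mB.
pose D i := if i == a then B else C i.
have -> : X a @^-1` B `&` \bigcap_(i in [set i | i != a]) X i @^-1` C i =
    \bigcap_(i in [set` [set: I]%SET]) X i @^-1` D i.
  rewrite eqEsubset; split=> w.
    move=> [Xa Xi] i _; rewrite /preimage /= /D; case: ifPn => [/eqP ->//|ia].
    exact: Xi.
  move=> Xw; split; first by have := Xw a; rewrite /preimage /= /D eqxx; apply; rewrite inE.
  by move=> i /= ia; have := Xw i; rewrite /preimage /= /D (negbTE ia); apply; rewrite inE.
rewrite X_indep//; [|exact: subset_predT|by move=> i _; rewrite /D; case: ifP].
rewrite (bigD1 a)//= {1}/D eqxx; congr (_ * _)%E.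
have -> : \bigcap_(i in [set i | i != a]) X i @^-1` C i =
    \bigcap_(i in [set` [set~ a]%SET]) X i @^-1` C i.
  by apply: eq_bigcapl; split=> i /=; rewrite !inE.
rewrite X_indep//; last exact: subset_predT.
apply: eq_big => i; first by rewrite !inE.
by rewrite !inE /= /D => /negbTE ->.
Qed.

(** Both sides are finite measures in [A] that agree on the pi-system of cylinders. *)
Let sigma_indep a (A : set T) (B : set R) :
  measurable B -> <<s other_cylinders a >> A ->
  P (X a @^-1` B `&` A) = (P (X a @^-1` B) * P A)%E.
Proof.
move=> mB; move: A.
have mXB : measurable (X a @^-1` B).
  by rewrite -[X in measurable X]setTI; exact: measurable_funP.
have pB : (0 <= fine (P (X a @^-1` B)))%R by exact: fine_ge0.
pose m1 : {measure set T -> \bar R} := mrestr P mXB.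
pose m2 : {measure set T -> \bar R} := mscale (NngNum pB) P.
have m1E A : m1 A = P (X a @^-1` B `&` A) by rewrite /m1 /mrestr setIC.
have m2E A : m2 A = (P (X a @^-1` B) * P A)%E.
  by rewrite -[X in (X * _)%E]fineK ?fin_num_measure.
move=> A sA; rewrite -m1E -m2E.
apply: (g_sigma_algebra_measure_unique (other_cylinders a) _ (fun=> setT) _ _ m1 m2) sA => //.
- exact: other_cylinders_measurable.
- by move=> _; exact: other_cylinders_setT.
- by rewrite bigcup_const.
- exact: other_cylinders_setI_closed.
- move=> C [D mD ->]; rewrite m1E cylinder_indep//.
- move=> _; rewrite (le_lt_trans (y := P setT))//.
    by apply: le_measure; rewrite ?inE//; exact: measurableI.
  by rewrite probability_setT ltry.
Qed.

Lemma mean_mul_free a (u : R -> R) (g : T -> R) :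
  measurable_fun setT u -> all_moments P (fun w => u (X a w)) ->
  free_of a g -> all_moments P g ->
  \int[P]_w (u (X a w) * g w) = \int[P]_w u (X a w) * \int[P]_w g w.
Proof.
move=> mu au fg ag.
pose S := g_sigma_algebraType (other_cylinders a).
(* [V] is the identity onto [T] with the sigma-algebra of the other variables; [free_of] says
   exactly that [g] is measurable on that space. *)
pose V : T -> S := fun w => w.
have mV : measurable_fun setT V.
  by move=> _ Y mY; rewrite setTI; exact: (@g_sigma_other_measurable a Y mY).
pose mV_mixin := isMeasurableFun.Build _ _ _ _ V mV.
pose VRV : {RV P >-> S} := MeasurableFun.Pack (MeasurableFun.Class mV_mixin).
have := @mean_mul_independent _ T R P _ _ _ _ (X a) VRV _ u (g : S -> R) mu fg.
apply => //; try exact: all_moments_integrable.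
- by move=> A B mA mB; exact: sigma_indep.
- by apply: all_moments_integrable; exact: all_momentsM.
Qed.

End FreeOf.

(** * Quadratic forms in independent variables *)

Ltac moments := intros; repeat first
  [ assumption | exact: all_moments_cst
  | match goal with H : forall _, all_moments _ _ |- _ => exact: H end
  | apply: all_momentsB | apply: all_momentsD | apply: all_momentsM
  | apply: all_momentsX | apply: all_moments_sum => ? _ ].

Ltac free := repeat first
  [ assumption | exact: free_of_cst
  | apply: free_ofX | apply: free_ofD | apply: free_ofM
  | apply: free_of_exp | apply: free_of_sum => ? ? ].

Section QuadraticForm.
Context d (T : measurableType d) (R : realType) (P : probability T R).
Variables (I : finType) (X : I -> {RV P >-> R}) (v : I -> R) (A : R).
Hypothesis X_indep : independent_on P predT X.
Hypothesis X_moments : forall a, all_moments P (X a).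

Local Notation E g := (Rintegral P setT g).

Hypothesis X_mean : forall a, E (X a) = 0.
Hypothesis X_var : forall a, E (fun w => X a w ^+ 2) = v a.
Hypothesis v_le : forall a, v a <= A.
Hypothesis X_fourth : forall a, E (fun w => X a w ^+ 4) <= A ^+ 2.

Lemma v_ge0 a : 0 <= v a.
Proof. by rewrite -X_var; apply: mean_ge0 => w; exact: sqr_ge0. Qed.

Let A_ge0 (a : I) : 0 <= A.
Proof. exact: le_trans (v_ge0 a) (v_le a). Qed.

Let mean0_mul_free a g : free_of X a g -> all_moments P g ->
  E (fun w => X a w * g w) = 0.
Proof.
move=> fg ag.
have mid : measurable_fun setT (@id R) by exact: measurable_id.
have := @mean_mul_free _ _ _ _ _ _ X_indep a id g mid (X_moments a) fg ag.
by rewrite X_mean mul0r.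
Qed.

Let var_mul_free a g : free_of X a g -> all_moments P g ->
  E (fun w => X a w ^+ 2 * g w) = v a * E g.
Proof.
move=> fg ag; rewrite -X_var.
have mu : measurable_fun setT (fun x : R => x ^+ 2) by exact: measurable_funX.
by apply: (@mean_mul_free _ _ _ _ _ _ X_indep a _ g mu) => //; moments.
Qed.

Let fourth_mul_free a g : free_of X a g -> all_moments P g ->
  E (fun w => X a w ^+ 4 * g w) = E (fun w => X a w ^+ 4) * E g.
Proof.
move=> fg ag.
have mu : measurable_fun setT (fun x : R => x ^+ 4) by exact: measurable_funX.
by apply: (@mean_mul_free _ _ _ _ _ _ X_indep a _ g mu) => //; moments.
Qed.

(** The product [X a * X b] minus its mean. Centring makes distinct unordered pairs orthogonal,
    diagonal pairs included. *)
Definition cprod (p : I * I) (w : T) : R := X p.1 w * X p.2 w - (p.1 == p.2)%:R * v p.1.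

Lemma all_moments_cprod p : all_moments P (cprod p).
Proof. by rewrite /cprod; moments. Qed.

Let free_of_cprod a p : p.1 != a -> p.2 != a -> free_of X a (cprod p).
Proof.
move=> p1 p2; rewrite (_ : cprod p = fun w => X p.1 w * X p.2 w +
  (- ((p.1 == p.2)%:R * v p.1))) //; free.
Qed.

(** [X p.1] occurs once among the four factors and has mean 0. *)
Let cprod_orth_alone p q : p.1 != p.2 -> p.1 != q.1 -> p.1 != q.2 ->
  E (fun w => cprod p w * cprod q w) = 0.
Proof.
move=> p12 p1 p2.
rewrite -(@mean0_mul_free p.1 (fun w => X p.2 w * cprod q w)).
- by apply: eq_Rintegral => w _; rewrite /cprod (negbTE p12) mul0r subr0 mulrA.
- by apply: free_ofM; [apply: free_ofX|apply: free_of_cprod]; rewrite eq_sym.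
- by have := all_moments_cprod q; moments.
Qed.

Let cprodC p : cprod (p.2, p.1) = cprod p.
Proof.
apply/funext => w; rewrite /cprod /= mulrC eq_sym.
by case: eqVneq => [->|] //; rewrite !mul0r.
Qed.

(** Unless [p] and [q] are the same unordered pair, either some index occurs once among the four and
    [cprod_orth_alone] applies, or both pairs are diagonal and the centred squares are
    independent. *)
Let cprod_orth p q : q != p -> q != (p.2, p.1) ->
  E (fun w => cprod p w * cprod q w) = 0.
Proof.
move=> qp qp'.
have [p12|p12] := eqVneq p.1 p.2; last first.
  have [p11|p11] := eqVneq p.1 q.1.
    have p22 : p.2 != q.2.
      by apply: contraNneq qp => e; rewrite [q]surjective_pairing [p]surjective_pairing -e -p11.
    rewrite -(@cprod_orth_alone (p.2, p.1) q) 1?eq_sym//= -?p11// 1?eq_sym//.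
    by apply: eq_Rintegral => w _; rewrite cprodC.
  have [p12'|p12'] := eqVneq p.1 q.2; last exact: cprod_orth_alone.
  rewrite -(@cprod_orth_alone (p.2, p.1) q)/= 1?eq_sym// -?p12'//.
    by apply: eq_Rintegral => w _; rewrite cprodC.
  by apply: contraNneq qp' => e; rewrite [q]surjective_pairing -e -p12'.
have [q12|q12] := eqVneq q.1 q.2.
  have pq : q.1 != p.1.
    by apply: contraNneq qp => e; rewrite [q]surjective_pairing [p]surjective_pairing -q12 -p12 e.
  pose u (x : R) := x ^+ 2 - v p.1.
  have mu : measurable_fun setT u.
    by apply: measurable_funB => //; exact: measurable_funX.
  have := @mean_mul_free _ _ _ _ _ _ X_indep p.1 u (cprod q) mu.
  have -> : E (fun w => u (X p.1 w)) = 0.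
    by rewrite meanB ?mean_cst ?X_var ?subrr//; moments.
  rewrite mul0r => <-.
  - by apply: eq_Rintegral => w _; rewrite /u /cprod -p12 eqxx mul1r expr2.
  - by rewrite /u; moments.
  - by apply: free_of_cprod => //; rewrite -q12.
  - exact: all_moments_cprod.
have [q1|q1] := eqVneq q.1 p.1.
  rewrite -(@cprod_orth_alone (q.2, q.1) p)/= -?p12 -?q1 1?eq_sym//.
  by apply: eq_Rintegral => w _; rewrite cprodC mulrC.
rewrite -(@cprod_orth_alone q p) -?p12//.
by apply: eq_Rintegral => w _; rewrite mulrC.
Qed.

Let cprod_sqr_off_diag p : p.1 != p.2 ->
  E (fun w => cprod p w ^+ 2) = v p.1 * v p.2.
Proof.
move=> p12.
rewrite (_ : E _ = E (fun w => X p.1 w ^+ 2 * X p.2 w ^+ 2)); last first.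
  by apply: eq_Rintegral => w _; rewrite /cprod (negbTE p12) mul0r subr0 exprMn.
rewrite var_mul_free ?X_var//; last by moments.
by apply: free_of_exp; apply: free_ofX; rewrite eq_sym.
Qed.

Let cprod_sqr_le p : E (fun w => cprod p w ^+ 2) <= A ^+ 2.
Proof.
have [p12|p12] := eqVneq p.1 p.2; last first.
  by rewrite cprod_sqr_off_diag// expr2 ler_pM ?v_ge0.
rewrite (_ : E _ = E (fun w => X p.1 w ^+ 4 - (2 * v p.1) * X p.1 w ^+ 2 + v p.1 ^+ 2)); last first.
  by apply: eq_Rintegral => w _; rewrite /cprod -p12 eqxx mul1r; ring.
rewrite meanD ?meanB ?meanZ ?X_var ?mean_cst; try by moments.
by have := X_fourth p.1; have := sqr_ge0 (v p.1); nra.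
Qed.

Definition qform (K : I -> I -> R) (w : T) : R :=
  \sum_p K p.1 p.2 * cprod p w.

Lemma all_moments_qform K : all_moments P (qform K).
Proof.
rewrite /qform; apply: all_moments_sum => p _.
by have := all_moments_cprod p; moments.
Qed.

(** By [cprod_orth] the pair [p] correlates only with itself and its transpose, where [K] and
    [cprod] take the same values; the two coincide on the diagonal, which the factor 2 then
    overcounts. *)
Lemma mean_sqr_qform_le_cprod (K : I -> I -> R) : (forall a b, K a b = K b a) ->
  E (fun w => qform K w ^+ 2) <=
  2 * \sum_p K p.1 p.2 ^+ 2 * E (fun w => cprod p w ^+ 2).
Proof.
move=> KC; have ac := all_moments_cprod.
rewrite (_ : E _ = E (fun w => \sum_p \sum_q
    (K p.1 p.2 * K q.1 q.2) * (cprod p w * cprod q w))); last first.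
  apply: eq_Rintegral => w _; rewrite /qform expr2 big_distrlr /=.
  by apply: eq_bigr => p _; apply: eq_bigr => q _; ring.
rewrite mean_sum => [|p _]; last by moments.
rewrite mulr_sumr; apply: ler_sum => p _.
rewrite mean_sum => [|q _]; last by moments.
set c := K p.1 p.2 ^+ 2 * E (fun w => cprod p w ^+ 2).
apply: (@le_trans _ _ (\sum_q ((q == p)%:R + (q == (p.2, p.1))%:R) * c)).
  apply: ler_sum => q _; rewrite meanZ; last by moments.
  have c_ge0 : 0 <= c.
    by apply: mulr_ge0; [exact: sqr_ge0|apply: mean_ge0 => w; exact: sqr_ge0].
  have [qp|qp] := boolP ((q == p) || (q == (p.2, p.1))); last first.
    move: qp; rewrite negb_or => /andP[qp qp'].
    by rewrite cprod_orth// mulr0 (negbTE qp) (negbTE qp') addr0 mul0r.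
  have -> : K q.1 q.2 = K p.1 p.2 by case/orP: qp => /eqP -> //=; rewrite KC.
  have -> : cprod q = cprod p by case/orP: qp => /eqP -> //=.
  rewrite -expr2 -/c ler_peMl// -natrD ler1n.
  by case: (q == p) qp => //= ->.
rewrite -mulr_suml big_split /=.
rewrite (bigD1 p)//= big1 => [|q /negbTE -> //].
rewrite (bigD1 (p.2, p.1))//= big1 => [|q /negbTE -> //].
by rewrite !eqxx !addr0.
Qed.

Lemma mean_sqr_qform_le (K : I -> I -> R) : (forall a b, K a b = K b a) ->
  E (fun w => qform K w ^+ 2) <= 2 * A ^+ 2 * \sum_p K p.1 p.2 ^+ 2.
Proof.
move=> KC; apply: le_trans (mean_sqr_qform_le_cprod KC) _.
rewrite -mulrA ler_pM2l// mulr_sumr; apply: ler_sum => p _.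
by rewrite mulrC ler_wpM2r ?sqr_ge0.
Qed.

(** Keeps the variances, whereas [mean_sqr_qform_le] bounds them by [A]. The right-hand side is what
    tends to the limiting variance, which matters when that limit is 0. *)
Lemma mean_sqr_qform_off_diag_le (K : I -> I -> R) : (forall a b, K a b = K b a) ->
  (forall a, K a a = 0) ->
  E (fun w => qform K w ^+ 2) <= 2 * \sum_p K p.1 p.2 ^+ 2 * (v p.1 * v p.2).
Proof.
move=> KC K0; apply: le_trans (mean_sqr_qform_le_cprod KC) _.
rewrite ler_pM2l//; apply: ler_sum => p _.
have [p12|p12] := eqVneq p.1 p.2.
  by rewrite -p12 K0 expr0n !mul0r.
by rewrite cprod_sqr_off_diag.
Qed.

Lemma mean_cprod p : E (cprod p) = 0.
Proof.
rewrite /cprod meanB ?mean_cst; try by moments.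
have [<-|p12] := eqVneq p.1 p.2.
  rewrite mul1r -X_var; apply/eqP; rewrite subr_eq0; apply/eqP.
  by apply: eq_Rintegral => w _; rewrite expr2.
rewrite mul0r subr0 mean0_mul_free//.
by apply: free_ofX; rewrite eq_sym.
Qed.

Lemma mean_qform L : E (qform L) = 0.
Proof.
rewrite /qform mean_sum => [|p _]; last by have := all_moments_cprod; moments.
rewrite big1// => p _; rewrite meanZ ?mean_cprod ?mulr0//.
exact: all_moments_cprod.
Qed.

(** * The approximate Stein identity for an off-diagonal form *)

Section SteinEstimate.
Variables (K : I -> I -> R) (kap rho : R).
Hypothesis KC : forall a b, K a b = K b a.
Hypothesis K0 : forall a, K a a = 0.
Hypothesis K_le : forall a b, `|K a b| <= kap.
Hypothesis K_row : forall a, \sum_b `|K a b| <= rho.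

Let Z w : R := \sum_a \sum_b K a b * (X a w * X b w).
(** The partial derivative of [Z] in [X a]; the 2 comes from the symmetry of [K]. *)
Let D a w : R := 2 * \sum_b K a b * X b w.
Let Zminus a w : R :=
  \sum_(b | b != a) \sum_(c | c != a) K b c * (X b w * X c w).

Let Z_split a w : Z w = Zminus a w + X a w * D a w.
Proof.
rewrite /Z /Zminus /D (bigD1 a)//= addrC.
rewrite (eq_bigr (fun b => \sum_(c | c != a) K b c * (X b w * X c w) +
    X a w * (K a b * X b w))) => [|b ba]; last first.
  by rewrite (bigD1 a)//= addrC (KC a b); congr (_ + _); ring.
rewrite big_split /= -addrA; congr (_ + _).
have -> : \sum_(b | b != a) X a w * (K a b * X b w) = X a w * \sum_b K a b * X b w.
  by rewrite -mulr_sumr; congr (_ * _); rewrite [RHS](bigD1 a)//= K0 mul0r add0r.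
have -> : \sum_b K a b * (X a w * X b w) = X a w * \sum_b K a b * X b w.
  by rewrite mulr_sumr; apply: eq_bigr => b _; ring.
by ring.
Qed.

(** Euler's identity for a form homogeneous of degree 2. *)
Let Z_half w : Z w = 2^-1 * \sum_a X a w * D a w.
Proof.
rewrite /Z mulr_sumr; apply: eq_bigr => a _; rewrite /D !mulr_sumr.
by apply: eq_bigr => b _; field.
Qed.

Let free_of_D a : free_of X a (D a).
Proof.
rewrite (_ : D a = fun w => 2 * \sum_(b | b != a) K a b * X b w).
  by free.
by apply/funext => w; rewrite /D (bigD1 a)//= K0 mul0r add0r.
Qed.

Let free_of_Zminus a : free_of X a (Zminus a).
Proof. by rewrite /Zminus; free. Qed.

Let all_moments_D a : all_moments P (D a).
Proof. by rewrite /D; moments. Qed.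

Let all_moments_Z : all_moments P Z.
Proof. by rewrite /Z; moments. Qed.

Let all_moments_Zminus a : all_moments P (Zminus a).
Proof. by rewrite /Zminus; moments. Qed.

Let kap_ge0 (a : I) : 0 <= kap.
Proof. exact: le_trans (normr_ge0 _) (K_le a a). Qed.

Let rho_ge0 (a : I) : 0 <= rho.
Proof. by apply: le_trans (K_row a); apply: sumr_ge0 => b _. Qed.

Let K_sqr_row a : \sum_b K a b ^+ 2 <= kap * rho.
Proof.
apply: (@le_trans _ _ (\sum_b kap * `|K a b|)).
  by apply: ler_sum => b _; rewrite -real_normK ?num_real// expr2 ler_wpM2r.
by rewrite -mulr_sumr ler_wpM2l// kap_ge0.
Qed.

(** A centred form plus a constant, so that the fourth moment of [D a] and the variance of [Tvar]
    both reduce to [mean_sqr_qform_le]. *)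
Let D_sqr a w : D a w ^+ 2 =
  qform (fun b c => 4 * (K a b * K a c)) w + 4 * \sum_b K a b ^+ 2 * v b.
Proof.
rewrite /D exprMn expr2 [X in _ * X]expr2 big_distrlr /= /qform pair_big /=.
have -> : \sum_b K a b ^+ 2 * v b =
    \sum_p (K a p.1 * K a p.2) * ((p.1 == p.2)%:R * v p.1).
  rewrite -(pair_bigA _ (fun b c => (K a b * K a c) * ((b == c)%:R * v b))) /=.
  apply: eq_bigr => b _; rewrite (bigD1 b)//= big1 => [|c /negbTE cb].
    by rewrite eqxx mul1r addr0 expr2.
  by rewrite eq_sym cb mul0r mulr0.
rewrite !mulr_sumr -big_split /=; apply: eq_bigr => p _.
by rewrite /cprod; ring.
Qed.

Let mean_D2 a : E (fun w => D a w ^+ 2) = 4 * \sum_b K a b ^+ 2 * v b.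
Proof.
rewrite (_ : E _ = E (fun w => qform (fun b c => 4 * (K a b * K a c)) w +
    4 * \sum_b K a b ^+ 2 * v b)); last by apply: eq_Rintegral => w _; exact: D_sqr.
rewrite meanD ?mean_cst ?mean_qform ?add0r//; last exact: all_moments_cst.
exact: all_moments_qform.
Qed.

Let mean_D2_le a : E (fun w => D a w ^+ 2) <= 4 * A * (kap * rho).
Proof.
rewrite mean_D2 -mulrA ler_pM2l// (le_trans (y := \sum_b A * K a b ^+ 2))//.
  by apply: ler_sum => b _; rewrite mulrC ler_wpM2r ?sqr_ge0.
by rewrite -mulr_sumr ler_wpM2l// (A_ge0 a).
Qed.

(** [D ^ 2 = Q + m] gives [D ^ 4 <= 2 * Q ^ 2 + 2 * m ^ 2]. The squared kernel of [Q] sums to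
    [16 * (\sum_b K a b ^ 2) ^ 2], and 96 is [2 * 2 * 16 + 2 * 16]. *)
Let mean_D4_le a : E (fun w => D a w ^+ 4) <= 96 * A ^+ 2 * (kap * rho) ^+ 2.
Proof.
pose Q := qform (fun b c => 4 * (K a b * K a c)).
pose m := 4 * \sum_b K a b ^+ 2 * v b.
have aQ : all_moments P Q by exact: all_moments_qform.
have m_ge0 : 0 <= m.
  by rewrite mulr_ge0// sumr_ge0// => b _; rewrite mulr_ge0 ?sqr_ge0 ?v_ge0.
have mle : m <= 4 * A * (kap * rho) by rewrite /m -mean_D2.
have kr : 0 <= kap * rho by rewrite mulr_ge0 ?kap_ge0 ?rho_ge0.
apply: (@le_trans _ _ (E (fun w => 2 * Q w ^+ 2 + 2 * m ^+ 2))).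
  apply: mean_le => [||w].
  - by have := all_moments_D a; moments.
  - by moments.
  - rewrite (_ : D a w ^+ 4 = (D a w ^+ 2) ^+ 2); last by rewrite -exprM.
    rewrite D_sqr -/Q -/m; have := sqr_ge0 (Q w - m); lra.
rewrite meanD ?mean_cst ?meanZ; try by moments.
have A22 : 0 <= 2 * A ^+ 2 by rewrite mulr_ge0// sqr_ge0.
have /le_trans QK := @mean_sqr_qform_le (fun b c => 4 * (K a b * K a c))
  (fun b c => congr1 _ (mulrC _ _)).
have {QK} Q2 : E (fun w => Q w ^+ 2) <= 2 * A ^+ 2 * (16 * (kap * rho) ^+ 2).
  apply: QK; rewrite ler_wpM2l//.
  rewrite (_ : \sum_p _ = 16 * (\sum_b K a b ^+ 2) ^+ 2).
    rewrite ler_pM2l// !expr2 ler_pM ?K_sqr_row// sumr_ge0// => b _; exact: sqr_ge0.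
  rewrite expr2 big_distrlr /= pair_big mulr_sumr; apply: eq_bigr => p _ /=.
  by ring.
have m2 : m ^+ 2 <= (4 * A * (kap * rho)) ^+ 2.
  by rewrite lerXn2r ?nnegrE// (le_trans m_ge0).
have -> : 96 * A ^+ 2 * (kap * rho) ^+ 2 =
  2 * (2 * A ^+ 2 * (16 * (kap * rho) ^+ 2)) + 2 * (4 * A * (kap * rho)) ^+ 2 by ring.
by rewrite lerD// ler_pM2l.
Qed.

(** [G] stands for the derivative of [F]. As it will be merely continuous, the remainders are stated
    with [eps + C * u ^ 2]; for [u = X a * D a] this calls for moments of order 2 and 4 only. *)
Variables (F G : R -> R) (M eps C : R).
Hypothesis mF : measurable_fun setT F.
Hypothesis mG : measurable_fun setT G.
Hypothesis F_le : forall x, `|F x| <= M.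
Hypothesis G_le : forall x, `|G x| <= M.
Hypothesis eps_ge0 : 0 <= eps.
Hypothesis C_ge0 : 0 <= C.
Hypothesis F_taylor : forall x u, `|F (x + u) - F x - u * G x| <= `|u| * (eps + C * u ^+ 2).
Hypothesis G_modulus : forall x u, `|G (x + u) - G x| <= eps + C * u ^+ 2.

Let all_moments_comp (H : R -> R) g : measurable_fun setT H -> (forall x, `|H x| <= M) ->
  all_moments P g -> all_moments P (fun w => H (g w)).
Proof.
move=> mH HM [mg _]; apply: (@all_moments_bounded _ _ _ _ _ M) => //.
exact: measurableT_comp.
Qed.

(* The linear term in [X a] vanishes because [Zminus a] does not involve [X a]. *)
Let stein_term a :
  `|E (fun w => X a w * D a w * F (Z w)) - E (fun w => v a * D a w ^+ 2 * G (Z w))|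
  <= 8 * eps * A ^+ 2 * (kap * rho) + 192 * C * A ^+ 4 * (kap * rho) ^+ 2.
Proof.
have aD := all_moments_D a; have fD := @free_of_D a.
have aZm := all_moments_Zminus a; have fZm := @free_of_Zminus a.
have aFZ := all_moments_comp mF F_le all_moments_Z.
have aGZ := all_moments_comp mG G_le all_moments_Z.
have aFZm := all_moments_comp mF F_le aZm.
have aGZm := all_moments_comp mG G_le aZm.
have fFZm := @free_of_comp _ _ _ _ _ _ a _ _ mF fZm.
have fGZm := @free_of_comp _ _ _ _ _ _ a _ _ mG fZm.
have E1 : E (fun w => X a w * (D a w * F (Zminus a w))) = 0.
  by apply: mean0_mul_free; [free|moments].
have E2 : E (fun w => X a w ^+ 2 * (D a w ^+ 2 * G (Zminus a w))) =
    E (fun w => v a * (D a w ^+ 2 * G (Zminus a w))).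
  by rewrite meanZ; [apply: var_mul_free; [free|moments]|moments].
(* Two terms evaluated at [Zminus a] are inserted: the linear one has mean 0 by [E1], and in the
   quadratic one [E2] replaces the square of [X a] by [v a]. What remains is a Taylor remainder of
   [F] and an increment of [G], both for the step [u = X a * D a]. *)
have -> : E (fun w => X a w * D a w * F (Z w)) - E (fun w => v a * D a w ^+ 2 * G (Z w)) =
  E (fun w => (X a w * D a w * F (Z w) - X a w * (D a w * F (Zminus a w)) -
      X a w ^+ 2 * (D a w ^+ 2 * G (Zminus a w))) +
     (v a * (D a w ^+ 2 * G (Zminus a w)) - v a * D a w ^+ 2 * G (Z w))).
  rewrite meanD ?meanB; try by moments.
  by rewrite E1 E2; ring.
apply: le_trans (@norm_mean_le _ _ _ _ _ (fun w =>
  (X a w ^+ 2 * (eps * D a w ^+ 2) + X a w ^+ 4 * (C * D a w ^+ 4)) +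
  (v a * eps * D a w ^+ 2 + X a w ^+ 2 * (v a * C * D a w ^+ 4))) _ _ _) _.
- by moments.
- by moments.
- move=> w; set u := X a w * D a w.
  have Zw : Z w = Zminus a w + u by rewrite (Z_split a).
  apply: le_trans (ler_normD _ _) (lerD _ _).
    have -> : u * F (Z w) - X a w * (D a w * F (Zminus a w)) -
        X a w ^+ 2 * (D a w ^+ 2 * G (Zminus a w)) =
        u * (F (Zminus a w + u) - F (Zminus a w) - u * G (Zminus a w)).
      by rewrite Zw /u; ring.
    rewrite normrM; apply: (@le_trans _ _ (`|u| * (`|u| * (eps + C * u ^+ 2)))).
      by rewrite ler_wpM2l.
    by rewrite mulrA -expr2 real_normK ?num_real// /u; lra.
  have -> : v a * (D a w ^+ 2 * G (Zminus a w)) - v a * D a w ^+ 2 * G (Z w) =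
     - (v a * D a w ^+ 2 * (G (Zminus a w + u) - G (Zminus a w))).
    by rewrite Zw; ring.
  have vD : 0 <= v a * D a w ^+ 2 by exact: mulr_ge0 (v_ge0 a) (sqr_ge0 _).
  rewrite normrN normrM (ger0_norm vD).
  apply: (@le_trans _ _ (v a * D a w ^+ 2 * (eps + C * u ^+ 2))).
    by rewrite ler_wpM2l.
  by rewrite /u; lra.
(* Each dominating term is a power of [X a] times a function of [D a], so its mean factors. *)
have f4 : free_of X a (fun w => D a w ^+ 4) by free.
rewrite !meanD; try by moments.
rewrite !var_mul_free ?fourth_mul_free; try by [free|moments].
rewrite !meanZ; try by moments.
have D2 := mean_D2_le a; have D4 := mean_D4_le a.
have X4 := X_fourth a; have va := v_ge0 a; have vA := v_le a.
have D2_ge0 : 0 <= E (fun w => D a w ^+ 2) by apply: mean_ge0 => w; exact: sqr_ge0.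
have D4_ge0 : 0 <= E (fun w => D a w ^+ 4).
  by apply: mean_ge0 => w; rewrite (exprM _ 2 2) sqr_ge0.
have X4_ge0 : 0 <= E (fun w => X a w ^+ 4).
  by apply: mean_ge0 => w; rewrite (exprM _ 2 2) sqr_ge0.
have A0 := A_ge0 a.
have kr : 0 <= kap * rho by rewrite mulr_ge0 ?kap_ge0 ?rho_ge0.
move: D2 D4 X4 D2_ge0 D4_ge0 X4_ge0.
set d2 := E (fun w => D a w ^+ 2); set d4 := E (fun w => D a w ^+ 4).
set x4 := E (fun w => X a w ^+ 4); set kr' := kap * rho in kr *.
move=> D2 D4 X4 d2_ge0 d4_ge0 x4_ge0.
have t1 : v a * (eps * d2) <= eps * (4 * A ^+ 2 * kr').
  rewrite mulrCA ler_wpM2l// (le_trans (y := A * (4 * A * kr')))//.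
    exact: ler_pM.
  by rewrite le_eqVlt; apply/orP; left; apply/eqP; ring.
have t2 : x4 * (C * d4) <= C * (96 * A ^+ 4 * kr' ^+ 2).
  rewrite mulrCA ler_wpM2l// (le_trans (y := A ^+ 2 * (96 * A ^+ 2 * kr' ^+ 2)))//.
    exact: ler_pM.
  by rewrite le_eqVlt; apply/orP; left; apply/eqP; ring.
have t3 : v a * (v a * C * d4) <= C * (96 * A ^+ 4 * kr' ^+ 2).
  rewrite (_ : v a * (v a * C * d4) = C * (v a ^+ 2 * d4)); last by ring.
  rewrite ler_wpM2l// (le_trans (y := A ^+ 2 * (96 * A ^+ 2 * kr' ^+ 2)))//.
    by rewrite ler_pM ?sqr_ge0// lerXn2r ?nnegrE.
  by rewrite le_eqVlt; apply/orP; left; apply/eqP; ring.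
lra.
Qed.

Let s := 2 * \sum_p K p.1 p.2 ^+ 2 * (v p.1 * v p.2).
Let Tvar w : R := 2^-1 * \sum_a v a * D a w ^+ 2.

(** [Tvar - s] is the quadratic form with kernel [L], and [\sum L ^ 2 <= max |L| * \sum |L|], where
    [max |L| <= 2 * A * kap * rho] and [\sum |L|] is at most [2 * A * rho ^ 2] times the number of
    indices. *)
Let mean_sqr_Tvar : E (fun w => (Tvar w - s) ^+ 2) <=
  8 * A ^+ 4 * (#|I|%:R * (kap * rho ^+ 3)).
Proof.
pose L b c := 2 * \sum_a v a * (K a b * K a c).
have LC b c : L b c = L c b by congr (2 * _); apply: eq_bigr => a _; rewrite (mulrC (K a b)).
rewrite (_ : E _ = E (fun w => qform L w ^+ 2)); last first.
  apply: eq_Rintegral => w _; congr (_ ^+ 2); rewrite /Tvar.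
  rewrite (eq_bigr (fun a => v a * qform (fun b c => 4 * (K a b * K a c)) w +
    v a * (4 * \sum_b K a b ^+ 2 * v b))); last by move=> a _; rewrite D_sqr mulrDr.
  rewrite big_split mulrDr /=.
  have -> : 2^-1 * \sum_a v a * (4 * \sum_b K a b ^+ 2 * v b) = s.
    rewrite /s -(pair_bigA _ (fun a b => K a b ^+ 2 * (v a * v b))) /= !mulr_sumr.
    apply: eq_bigr => a _; rewrite !mulr_sumr; apply: eq_bigr => b _; by field.
  rewrite addrK /qform /L mulr_sumr.
  rewrite (eq_bigr (fun a => \sum_p 2 * (v a * (K a p.1 * K a p.2)) * cprod p w)).
    rewrite exchange_big /=; apply: eq_bigr => p _.
    by rewrite mulr_sumr mulr_suml.
  by move=> a _; rewrite !mulr_sumr; apply: eq_bigr => p _; field.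
apply: le_trans (mean_sqr_qform_le LC) _.
(* [A], [kap] and [rho] are known to be nonnegative only through an index, so the empty index set is
   treated apart. *)
have [I0|] := posnP #|I|.
  rewrite big1 ?I0 ?mul0r ?mulr0// => -[a b].
  by have := fintype0 a I0.
rewrite lt0n => /eqP/eqP; rewrite -lt0n => /card_gt0P[a0 _].
have A0 := A_ge0 a0; have k0 := kap_ge0 a0; have r0 := rho_ge0 a0.
have Labs b c : `|L b c| <= 2 * A * \sum_a `|K a b| * `|K a c|.
  rewrite /L normrM ger0_norm// -mulrA ler_pM2l// mulr_sumr.
  apply: le_trans (ler_norm_sum _ _ _) (ler_sum _ _) => a _.
  rewrite normrM (ger0_norm (v_ge0 a)) normrM ler_wpM2r ?mulr_ge0//.
have Lmax b c : `|L b c| <= 2 * A * (kap * rho).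
  apply: le_trans (Labs b c) _; rewrite ler_wpM2l ?mulr_ge0//.
  apply: (@le_trans _ _ (\sum_a kap * `|K c a|)).
    by apply: ler_sum => a _; rewrite (KC c a) ler_wpM2r.
  by rewrite -mulr_sumr ler_wpM2l.
have Lsum : \sum_p `|L p.1 p.2| <= 2 * A * (#|I|%:R * rho ^+ 2).
  apply: (@le_trans _ _ (\sum_p 2 * A * \sum_a `|K a p.1| * `|K a p.2|)).
    by apply: ler_sum => p _; exact: Labs.
  rewrite -mulr_sumr ler_wpM2l ?mulr_ge0// exchange_big /=.
  apply: (@le_trans _ _ (\sum_(a : I) rho ^+ 2)).
    apply: ler_sum => a _.
    rewrite -(pair_bigA _ (fun b c => `|K a b| * `|K a c|)) /=.
    rewrite (_ : \sum_b _ = (\sum_b `|K a b|) ^+ 2).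
      by rewrite lerXn2r ?nnegrE// sumr_ge0.
    by rewrite expr2 big_distrlr.
  by rewrite sumr_const mulr_natl.
apply: (@le_trans _ _ (2 * A ^+ 2 * ((2 * A * (kap * rho)) * (2 * A * (#|I|%:R * rho ^+ 2))))).
  rewrite ler_wpM2l//; first by rewrite mulr_ge0// sqr_ge0.
  apply: (@le_trans _ _ (\sum_p (2 * A * (kap * rho)) * `|L p.1 p.2|)).
    apply: ler_sum => p _; rewrite -real_normK ?num_real// expr2 ler_wpM2r//.
  by rewrite -mulr_sumr ler_wpM2l// !mulr_ge0.
by rewrite le_eqVlt; apply/orP; left; apply/eqP; ring.
Qed.

(** The factors 4 and 96 are half of those in [stein_term], by [Z_half]. The last summand pays for
    replacing [Tvar] by its mean [s], with [eta] a free parameter. *)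
Lemma stein_estimate eta : 0 < eta ->
  `|E (fun w => qform K w * F (qform K w)) -
    2 * (\sum_p K p.1 p.2 ^+ 2 * (v p.1 * v p.2)) * E (fun w => G (qform K w))| <=
  #|I|%:R * (4 * eps * A ^+ 2 * (kap * rho) + 96 * C * A ^+ 4 * (kap * rho) ^+ 2) +
  M * (eta + eta^-1 * (8 * A ^+ 4 * (#|I|%:R * (kap * rho ^+ 3)))).
Proof.
move=> eta0; rewrite -/s (_ : qform K = Z); last first.
  apply/funext => w; rewrite /qform /Z (pair_bigA _ (fun a b => K a b * (X a w * X b w))) /=.
  apply: eq_bigr => p _; rewrite /cprod; have [<-|_] := eqVneq p.1 p.2.
    by rewrite K0 !mul0r.
  by rewrite mul0r subr0.
have aFZ := all_moments_comp mF F_le all_moments_Z.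
have aGZ := all_moments_comp mG G_le all_moments_Z.
have aZ := all_moments_Z; have aD := all_moments_D.
have aT : all_moments P Tvar by rewrite /Tvar; moments.
have -> : E (fun w => Z w * F (Z w)) - s * E (fun w => G (Z w)) =
   (E (fun w => Z w * F (Z w)) - E (fun w => Tvar w * G (Z w))) +
   E (fun w => (Tvar w - s) * G (Z w)).
  rewrite (_ : E (fun w => (Tvar w - s) * G (Z w)) =
    E (fun w => Tvar w * G (Z w) - s * G (Z w))); last first.
    by apply: eq_Rintegral => w _; rewrite mulrBl.
  by rewrite meanB ?meanZ ?subrKA//; moments.
apply: le_trans (ler_normD _ _) (lerD _ _).
  have -> : E (fun w => Z w * F (Z w)) = 2^-1 * \sum_a E (fun w => X a w * D a w * F (Z w)).
    rewrite -mean_sum -?meanZ; [|by moments|by moments].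
    by apply: eq_Rintegral => w _; rewrite Z_half -mulrA mulr_suml.
  have -> : E (fun w => Tvar w * G (Z w)) = 2^-1 * \sum_a E (fun w => v a * D a w ^+ 2 * G (Z w)).
    rewrite -mean_sum -?meanZ; [|by moments|by moments].
    by apply: eq_Rintegral => w _; rewrite -mulrA mulr_suml.
  rewrite -mulrBr -sumrB normrM ger0_norm//.
  apply: (@le_trans _ _ (2^-1 * \sum_(a : I)
     (8 * eps * A ^+ 2 * (kap * rho) + 192 * C * A ^+ 4 * (kap * rho) ^+ 2))).
    rewrite ler_pM2l// (le_trans (ler_norm_sum _ _ _))//.
    by apply: ler_sum => a _; exact: stein_term.
  rewrite sumr_const -mulr_natl.
  by rewrite le_eqVlt; apply/orP; left; apply/eqP; field.
have M_ge0 : 0 <= M := le_trans (normr_ge0 _) (F_le 0).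
(* The inequality [|t| <= eta + t ^ 2 / eta] takes the place of Cauchy-Schwarz. *)
apply: (@le_trans _ _ (E (fun w => M * (eta + eta^-1 * (Tvar w - s) ^+ 2)))).
  apply: norm_mean_le => [||w]; [by moments|by moments|].
  rewrite normrM mulrC ler_pM//.
  have [le|/ltW le] := leP `|Tvar w - s| eta.
    by rewrite (le_trans le)// lerDl mulr_ge0 ?sqr_ge0// invr_ge0 ltW.
  rewrite (le_trans (y := eta^-1 * (Tvar w - s) ^+ 2))//; last by rewrite lerDr ltW.
  by rewrite -real_normK ?num_real// expr2 mulrA ler_peMl// mulrC ler_pdivlMr// mul1r.
rewrite meanZ ?meanD ?meanZ ?mean_cst; try by moments.
rewrite ler_wpM2l// lerD2l ler_wpM2l ?invr_ge0 ?(ltW eta0)//.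
Qed.

End SteinEstimate.

End QuadraticForm.

(** * Stein's equation with compactly supported data *)

Section CompactSupport.
Context (R : realType).
Implicit Types (f : R -> R) (L : R).

Definition vanishes_off L f := forall x : R, L <= `|x| -> f x = 0.

Lemma csupp_bounded f L : continuous f -> vanishes_off L f ->
  exists M, forall x, `|f x| <= M.
Proof.
move=> cf f0.
have [LN|L0] := leP L 0.
  by exists 0 => x; rewrite f0 ?normr0// (le_trans LN).
have cnf : {within `[- L, L], continuous (fun x => `|f x|)}.
  apply: continuous_subspaceT => x.
  exact: (continuous_comp (cf x) (@norm_continuous _ _ _)).
have [|c _ cmax] := EVT_max _ cnf; first by lra.
exists `|f c| => x.
have [xL|/ltW xL] := leP `|x| L; last by rewrite f0 // normr0.
by apply: cmax; rewrite in_itv /= -ler_norml.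
Qed.

(** Compactness is used on [[- (L + 1), L + 1]]; the margin 1 ensures that a point beyond it stays
    off the support when moved by less than 1. *)
Lemma csupp_uniform f L : continuous f -> vanishes_off L f ->
  forall eps, 0 < eps -> exists2 delta, 0 < delta &
    forall x u, `|u| < delta -> `|f (x + u) - f x| < eps.
Proof.
move=> cf f0 eps eps0.
have [LN|L0] := leP L 0.
  by exists 1 => // x u _; rewrite !f0 ?subrr ?normr0// (le_trans LN).
have cpt := (compact_near_coveringP _).1 (@segment_compact R (- (L + 1)) (L + 1)).
have : \forall e \near (0 : R)^'+, `[- (L + 1), L + 1] `<=`
    [set x | forall u, `|u| < e -> `|f (x + u) - f x| < eps].
  apply: cpt => x _.
  have /cvgrPdist_lt/(_ (eps / 2)) := cf x; rewrite divr_gt0// => /(_ isT).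
  rewrite -nbhs_nearE => /nbhs_ballP[r /= r0 fr].
  exists (ball x (r / 2), [set e : R | e < r / 2]).
    split; first by apply: nbhsx_ballx; rewrite divr_gt0.
    by apply: nbhs_right_lt; rewrite divr_gt0.
  move=> [y e] /= [xy er] u ue.
  have xy' : `|x - y| < r / 2 by exact: xy.
  have h1 : `|f x - f y| < eps / 2.
    by apply: fr; rewrite /ball /=; lra.
  have h2 : `|f x - f (y + u)| < eps / 2.
    apply: fr; rewrite /ball /= opprD addrA (le_lt_trans (ler_normB _ _))//; lra.
  rewrite (_ : _ - _ = (f x - f y) - (f x - f (y + u))); last by ring.
  rewrite (le_lt_trans (ler_normB _ _))//; lra.
move=> near_e; near (0 : R)^'+ => e.
have e0 : 0 < e by [].
exists (Num.min e 1); first by rewrite lt_min e0 ltr01.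
move=> x u; rewrite lt_min => /andP[ue u1].
have [xL|xL] := leP `|x| (L + 1).
  have He : `[- (L + 1), L + 1] `<=`
    [set x | forall u, `|u| < e -> `|f (x + u) - f x| < eps] by near: e.
  by apply: (He x) => //; rewrite /= in_itv /= -ler_norml.
rewrite !f0 ?subrr ?normr0//; first lra.
have := lerB_dist (x + u) u; rewrite addrK => h.
by have := ler_normB (x + u) u; rewrite addrK; lra.
Unshelve. all: by end_near. Qed.

(** Uniform continuity handles [|u| < del]; for larger [u] the trivial bound [2 * M] is at most
    [2 * M / del ^ 2 * u ^ 2]. A modulus quadratic in [u] can be averaged by means of moments. *)
Lemma csupp_modulus f L : continuous f -> vanishes_off L f ->
  forall eps, 0 < eps -> exists2 C, 0 <= C &
    forall x u, `|f (x + u) - f x| <= eps + C * u ^+ 2.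
Proof.
move=> cf f0 eps eps0.
have [M fM] := csupp_bounded cf f0.
have M0 : 0 <= M := le_trans (normr_ge0 _) (fM 0).
have [del del0 fdel] := csupp_uniform cf f0 eps0.
exists (2 * M / del ^+ 2); first by rewrite divr_ge0 ?sqr_ge0// mulr_ge0.
move=> x u; have [|ud] := ltP `|u| del.
  move=> /(fdel x)/ltW/le_trans; apply; rewrite lerDl mulr_ge0 ?sqr_ge0//.
  by rewrite divr_ge0 ?sqr_ge0// mulr_ge0.
apply: (@le_trans _ _ (2 * M)).
  by rewrite (le_trans (ler_normB _ _))// mulr_natl mulr2n lerD.
apply: (@le_trans _ _ (2 * M / del ^+ 2 * u ^+ 2)); last by rewrite lerDr ltW.
rewrite -mulrA ler_peMr ?mulr_ge0// mulrC ler_pdivlMr ?exprn_gt0// mul1r.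
by rewrite -(real_normK (num_real u)) lerXn2r ?nnegrE// ltW.
Qed.

(** By the mean value theorem the increment is [u * G c] for some [c] within [|u|] of [x], and the
    modulus increases with the distance. *)
Lemma taylor1_modulus (F G : R -> R) eps C :
  (forall x : R, is_derive x 1 F (G x)) -> 0 <= C ->
  (forall x u, `|G (x + u) - G x| <= eps + C * u ^+ 2) ->
  forall x u, `|F (x + u) - F x - u * G x| <= `|u| * (eps + C * u ^+ 2).
Proof.
move=> FG C0 Gm x u.
have cF : continuous F.
  by move=> y; apply: differentiable_continuous; apply/derivable1_diffP; case: (FG y).
have mvt (a b : R) : a <= b -> exists2 c, a <= c <= b & F b - F a = G c * (b - a).
  move=> ab; have [c] := MVT_segment ab (fun y _ => FG y) (continuous_subspaceT cF).
  by rewrite in_itv /= => cab eF; exists c.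
have [c [cu eF]] : exists c, `|c - x| <= `|u| /\ F (x + u) - F x = G c * u.
  have [u0|/ltW u0] := leP 0 u.
    have [|c cxu ->] := mvt x (x + u); first by rewrite lerDl.
    exists c; split; last by rewrite addrC addKr.
    by rewrite (ger0_norm u0) ger0_norm; lra.
  have [|c cxu eF] := mvt (x + u) x; first by rewrite gerDl.
  exists c; split; last by rewrite -opprB eF; ring.
  by rewrite (ler0_norm u0) ler0_norm; lra.
rewrite eF mulrC -mulrBr normrM ler_wpM2l//.
have := Gm x (c - x); rewrite subrKC => /le_trans; apply.
rewrite lerD2l ler_wpM2l// -(real_normK (num_real u)) -(real_normK (num_real (c - x))).
by rewrite lerXn2r ?nnegrE.
Qed.

End CompactSupport.

Section SteinEquation.
Context (R : realType) (s : R).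
Hypothesis s0 : 0 < s.
Let s_neq0 : s != 0 := lt0r_neq0 s0.
Local Notation mu := (@lebesgue_measure R).
Local Notation p := (normal_pdf 0 s).

Let pE x : p x = normal_peak s * expR (- x ^+ 2 / (s ^+ 2 *+ 2)).
Proof. by rewrite normal_pdfE// /normal_fun subr0. Qed.

(** The Radon-Nikodym derivative of the normal law agrees almost everywhere with [p], as both have
    the same integral over every measurable set. *)
Lemma integral_normal_prob (f : R -> R) : measurable_fun setT f ->
  (normal_prob 0 s).-integrable setT (EFin \o f) ->
  \int[normal_prob 0 s]_x f x = \int[mu]_x (f x * p x).
Proof.
move=> mf If; congr fine.
rewrite -(Radon_Nikodym_change_of_variables (normal_prob_dominates 0 s))//=.
apply: ae_eq_integral => //.
- apply: emeasurable_funM; first exact/measurable_EFinP.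
  apply: (measurable_int mu).
  by apply: Radon_Nikodym_integrable; exact: normal_prob_dominates.
- apply/measurable_EFinP; apply: measurable_funM => //; exact: measurable_normal_pdf.
- under [X in ae_eq _ _ _ X]eq_fun do rewrite EFinM.
  apply: ae_eqe_mul2l => /=.
  rewrite Radon_NikodymE//=; first exact: normal_prob_dominates.
  move=> numu; case: cid => /= h [h1 h2 h3].
  apply: integral_ae_eq => //=.
  + by apply/measurable_EFinP; exact: measurable_normal_pdf.
  + by move=> E _ mE; rewrite -h3.
Qed.

(* [F x = (s ^ 2 * p x)^-1 * \int_(t <= x) psi t * p t] also vanishes to the right
   of the support of [psi], because [psi] has mean 0. *)
Lemma stein_solution (psi : R -> R) L : continuous psi -> vanishes_off L psi ->
  \int[normal_prob 0 s]_x psi x = 0 ->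
  exists F G : R -> R, [/\ forall x : R, is_derive x 1 F (G x), continuous G,
    vanishes_off L F, vanishes_off L G & forall x, s ^+ 2 * G x - x * F x = psi x].
Proof.
move=> cpsi psi0 mean0.
have mpsi := continuous_measurable_fun cpsi.
have [M psiM] := csupp_bounded cpsi psi0.
pose g x := psi x * p x.
have mg : measurable_fun setT g.
  by apply: measurable_funM => //; exact: measurable_normal_pdf.
have Ig : mu.-integrable setT (EFin \o g).
  apply: (@le_integrable _ _ _ mu setT measurableT _ (fun x => (M%:E * (p x)%:E)%E)).
  - exact/measurable_EFinP.
  - move=> x _; rewrite /g /= lee_fin !normrM ler_wpM2r//.
    by rewrite (le_trans (psiM x))// ler_norm.
  - by apply: integrableZl => //; exact: integrable_normal_pdf.
pose H x := \int[mu]_(t in `]-oo, x]) g t.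
have cg : continuous g.
  by move=> x; apply: continuousM; [exact: cpsi|exact: continuous_normal_pdf].
have dH (x : R) : is_derive x 1 H (g x).
  have Iu : mu.-integrable [set` Interval (BInfty R true) (BRight (x + 1))] (EFin \o g).
    exact: integrableS Ig.
  have [|||dx <-] := @continuous_FTC1 _ g _ x (x + 1) _ Iu.
  - by rewrite ltrDl.
  - by rewrite /Order.lt /= num_real.
  - exact: cg.
  - by split => //; rewrite derive1E.
have H0 : vanishes_off L H.
  move=> x; rewrite ler_normr => /orP[Lx|xL]; rewrite /H.
    have -> : \int[mu]_(t in `]-oo, x]) g t = \int[mu]_t g t.
      rewrite Rintegral_mkcond; apply: eq_Rintegral => t _.
      rewrite patchE; case: ifPn => // /negP tx; rewrite /g psi0 ?mul0r//.
      rewrite ler_normr; apply/orP; left; apply: (le_trans Lx).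
      rewrite leNgt; apply/negP => xt; apply: tx.
      by rewrite inE /= in_itv /= ltW.
    rewrite -integral_normal_prob//; apply: all_moments_integrable.
    exact: (@all_moments_bounded _ _ _ _ _ M).
  transitivity (\int[mu]_(t in `]-oo, x]) (0 : R)); last first.
    by rewrite Rintegral_cst ?mul0r.
  apply: eq_Rintegral => t; rewrite inE /= in_itv /= => tx.
  rewrite /g psi0 ?mul0r// ler_normr; apply/orP; right; lra.
(* [q = (s ^ 2 * p)^-1], in closed form so that its derivative [x / s ^ 2 * q] is a computation. *)
pose q x := (s ^+ 2 * normal_peak s)^-1 * expR ((s ^+ 2 *+ 2)^-1 * x ^+ 2).
have pq x : p x * q x = s ^- 2.
  rewrite pE /q mulrACA -expRD !mulNr [_^-1 * _ ^+ 2]mulrC addNr expR0 mulr1.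
  by rewrite invfM mulrCA divff ?mulr1// gt_eqF// normal_peak_gt0.
have dq (x : R) : is_derive x 1 q (x / s ^+ 2 * q x).
  by apply: is_derive_eq; rewrite /q /GRing.scale /=; field; rewrite s_neq0 gt_eqF// normal_peak_gt0.
pose F x := H x * q x.
(* Stein's equation solved for the derivative; [dF] checks that this is the derivative of [F]. *)
pose G x := s ^- 2 * (psi x + x * F x).
have F0 : vanishes_off L F by move=> x xL; rewrite /F H0 ?mul0r.
have dF (x : R) : is_derive x 1 F (G x).
  apply: is_derive_eq; rewrite /G /F /GRing.scale /=.
  have e : s ^- 2 * psi x = q x * g x by rewrite /g -(pq x); ring.
  by rewrite mulrDr e; ring.
have cF : continuous F.
  by move=> x; apply: differentiable_continuous; apply/derivable1_diffP; case: (dF x).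
exists F, G; split => //.
- move=> x; apply: cvgM; first exact: cvg_cst.
  by apply: cvgD; [exact: cpsi|apply: cvgM; [exact: cvg_id|exact: cF]].
- by move=> x xL; rewrite /G psi0 ?F0// mulr0 addr0 mulr0.
- by move=> x; rewrite /G; field.
Qed.

End SteinEquation.

(** * Convergence in distribution *)

Section Cutoff.
Context (R : realType).

Definition cutoff (L x : R) : R := Num.max 0 (Num.min 1 (L + 1 - `|x|)).

Lemma cutoff_continuous L : continuous (cutoff L).
Proof.
have cn : continuous (fun x : R => L + 1 - `|x|).
  by move=> x; apply: cvgB; [exact: cvg_cst|exact: norm_continuous].
have c0 : continuous (fun _ : R => 0 : R) by move=> x; exact: cvg_cst.
have c1 : continuous (fun _ : R => 1 : R) by move=> x; exact: cvg_cst.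
move=> x; exact: (continuous_max (@c0 x) (continuous_min (@c1 x) (@cn x))).
Qed.

Lemma cutoff_ge0 L x : 0 <= cutoff L x.
Proof. by rewrite le_max lexx. Qed.

Lemma cutoff_le1 L x : cutoff L x <= 1.
Proof. by rewrite ge_max ler01 ge_min lexx. Qed.

Lemma cutoff_vanishes L : vanishes_off (L + 1) (cutoff L).
Proof.
move=> x Lx; apply/max_idPl; rewrite ge_min; apply/orP; right.
by rewrite subr_le0.
Qed.

Lemma cutoff_eq1 L x : `|x| <= L -> cutoff L x = 1.
Proof.
move=> xL; rewrite /cutoff min_l; last by lra.
by apply/max_idPr.
Qed.

(** Chebyshev's inequality before taking means. *)
Lemma subr1_cutoff_le L x : 0 < L -> 1 - cutoff L x <= x ^+ 2 / L ^+ 2.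
Proof.
move=> L0; have [xL|Lx] := leP `|x| L.
  by rewrite cutoff_eq1// subrr divr_ge0 ?sqr_ge0.
apply: (@le_trans _ _ 1); first by rewrite gerBl cutoff_ge0.
rewrite ler_pdivlMr ?exprn_gt0// mul1r -(real_normK (num_real x)).
by rewrite lerXn2r ?nnegrE// ?ltW.
Qed.

Local Notation RR := (measurableTypeR R).

(** The balls of radius [n] increase to the whole line, so their mass tends to 1, and the cutoff
    equals 1 on them. *)
Lemma mean_cutoff_near1 (nu : probability RR R) eps : 0 < eps ->
  exists n : nat, forall m : nat, (n <= m)%N -> 1 - \int[nu]_x cutoff m%:R x < eps.
Proof.
move=> eps0.
pose F (n : nat) : set RR := [set x : R | `|x| <= n%:R].
have mF n : measurable (F n).
  rewrite (_ : F n = `[- n%:R, n%:R]%classic) //.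
  by apply/seteqP; split=> x; rewrite /F /= in_itv /= ler_norml.
have FT : \bigcup_n F n = setT.
  apply/seteqP; split=> // x _; exists (Num.truncn `|x|).+1 => //=.
  by rewrite /F /= ltW// Num.Theory.truncnS_gt.
have ndF : nondecreasing_seq F.
  by move=> m n mn; apply/subsetPset => x; rewrite /F /= => /le_trans; apply; rewrite ler_nat.
have nuF : nu (F n) @[n --> \oo] --> (1 : R)%:E.
  rewrite -(probability_setT nu) -FT.
  exact: nondecreasing_cvg_mu mF (bigcupT_measurable _ mF) ndF.
have : fine (nu (F n)) @[n --> \oo] --> (1 : R) by exact: fine_cvg nuF.
move=> /cvgrPdist_lt/(_ _ eps0)[n _ nuFn]; exists n => // m nm.
apply: le_lt_trans (nuFn m nm).
apply: le_trans (ler_norm _); rewrite lerD2l lerN2.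
have mc := continuous_measurable_fun (@cutoff_continuous m%:R).
have ac : all_moments nu (cutoff m%:R).
  apply: (@all_moments_bounded _ _ _ _ _ 1) => // x.
  by rewrite ger0_norm ?cutoff_ge0// cutoff_le1.
have <- : \int[nu]_x (\1_(F m) x : R) = fine (nu (F m)).
  by rewrite /Rintegral integral_indic// setIT.
apply: mean_le => //.
  have m1 : measurable_fun setT (\1_(F m) : RR -> R) by exact: measurable_indic.
  apply: (@all_moments_bounded _ _ _ _ _ 1) m1 _ => x.
  by rewrite indicE; case: (_ \in _); rewrite ?normr1 ?normr0.
move=> x; rewrite indicE; have [|] := boolP (x \in F m).
  by rewrite inE => Fx; rewrite cutoff_eq1.
by rewrite cutoff_ge0.
Qed.

(* A bounded continuous [phi] is close to [phi * cut], which differs from a test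
   function of mean 0 by a multiple of [cut]; by Chebyshev both laws give [cut]
   mass nearly 1. *)
Lemma cvg_in_distribution_csupp (d : nat -> measure_display)
    (T : forall N, measurableType (d N)) (P : forall N, probability (T N) R)
    (Y : forall N, T N -> R) (nu : probability RR R) (V : R) :
  (forall N, all_moments (P N) (Y N)) ->
  (\forall N \near \oo, \int[P N]_w Y N w ^+ 2 <= V) ->
  (forall (psi : R -> R) L, continuous psi -> vanishes_off L psi ->
     \int[nu]_x psi x = 0 ->
     (\int[P N]_w psi (Y N w) @[N --> \oo] --> (0 : R))) ->
  cvg_in_distribution P Y nu.
Proof.
move=> aY YV psi_cvg phi cphi [M phiM].
have M0 : 0 <= M := le_trans (normr_ge0 _) (phiM 0).
have mphi := continuous_measurable_fun cphi.
have acomp (f : R -> R) K : continuous f -> (forall x, `|f x| <= K) ->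
    (forall N, all_moments (P N) (fun w => f (Y N w))) /\ all_moments nu f.
  move=> cf fK; have mf := continuous_measurable_fun cf; split=> [N|].
    apply: (@all_moments_bounded _ _ _ _ _ K) => //.
    by apply: measurableT_comp => //; case: (aY N).
  exact: (@all_moments_bounded _ _ _ _ _ K).
have [aphi nuphi] := acomp _ _ cphi phiM.
rewrite (_ : (fun N => _) = fun N => (\int[P N]_w phi (Y N w))%:E); last first.
  apply/funext => N; rewrite unlock /Rintegral fineK//.
  exact: integrable_fin_num (all_moments_integrable (aphi N)).
rewrite (_ : (\int[nu]_x (phi x)%:E)%E = (\int[nu]_x phi x)%:E); last first.
  by rewrite /Rintegral fineK//; exact: integrable_fin_num (all_moments_integrable nuphi).
apply: cvg_EFin; first by near=> N.
apply/cvgrPdist_le => eps eps0.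
(* Four errors of at most [eps / 6] make up the final estimate: one for each of the two cutoffs, one
   for the multiple of [cut], one for [psi]. The bound [e <= 2^-1] keeps the mass [c] away from 0,
   and [M + 1] avoids a division by 0. *)
pose e := Num.min 2^-1 (eps / (6 * (M + 1))).
have M10 : 0 < M + 1 by lra.
have e0 : 0 < e by rewrite lt_min invr_gt0 ltr0n divr_gt0// mulr_gt0.
have e2 : e <= 2^-1 by rewrite ge_min lexx.
have eeps : (M + 1) * e <= eps / 6.
  rewrite mulrC -ler_pdivlMr// /e ge_min; apply/orP; right.
  by rewrite invfM mulrA.
have [n Hn] := mean_cutoff_near1 nu e0.
(* Large enough for [nu] by the choice of [n], and for the laws of [Y N] through Chebyshev:
   [|V| / L ^ 2 <= |V| / L <= e] because [L >= 1]. *)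
pose m := maxn n (Num.truncn (`|V| / e)).+1.
pose L : R := m%:R.
have L1 : 1 <= L by rewrite ler1n leq_max orbT.
have L0 : 0 < L by lra.
have VL : V / L ^+ 2 <= e.
  rewrite ler_pdivrMr ?exprn_gt0// (le_trans (ler_norm V))// mulrC -ler_pdivrMr//.
  apply: (@le_trans _ _ L); last by rewrite expr2 ler_peMr// ltW.
  by rewrite ltW// (lt_le_trans (Num.Theory.truncnS_gt _))// ler_nat leq_maxr.
have /= c_near := Hn m (leq_maxl _ _); rewrite -/L in c_near.
pose cut := cutoff L.
have [acut nucut] : (forall N, all_moments (P N) (fun w => cut (Y N w))) /\ all_moments nu cut.
  apply: (@acomp _ 1); first exact: cutoff_continuous.
  by move=> x; rewrite ger0_norm ?cutoff_ge0// cutoff_le1.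
pose c := \int[nu]_x cut x; pose b := \int[nu]_x (phi x * cut x).
pose psi x := phi x * cut x - b / c * cut x.
have c_gt0 : 0 < c by rewrite /c /cut; lra.
have cc : continuous (fun x => phi x * cut x).
  by move=> x; apply: cvgM; [exact: cphi|exact: cutoff_continuous].
have nuphicut : all_moments nu (fun x => phi x * cut x) by exact: all_momentsM.
have b_le : `|b| <= M * c.
  rewrite /c -meanZ//; apply: norm_mean_le => //; first exact: all_momentsZ.
  by move=> x; rewrite normrM (ger0_norm (cutoff_ge0 _ _)) ler_wpM2r// cutoff_ge0.
have bc_le : `|b / c| <= M.
  by rewrite normrM normfV (gtr0_norm c_gt0) ler_pdivrMr.
have cpsi : continuous psi.
  move=> x; apply: cvgB; first exact: cc.
  by apply: cvgM; [exact: cvg_cst|exact: cutoff_continuous].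
have psi0 : vanishes_off (L + 1) psi.
  by move=> x xL; rewrite /psi /cut cutoff_vanishes// !mulr0 subrr.
have mean_psi : \int[nu]_x psi x = 0.
  rewrite /psi meanB ?meanZ//; last exact: all_momentsZ.
  by rewrite -/c -/b divfK ?subrr// gt_eqF.
have tail : `|\int[nu]_x phi x - b| <= M * (1 - c).
  rewrite -meanB// -(mean_cst nu 1) -meanB//; last exact: all_moments_cst.
  have a1c : all_moments nu (fun x => 1 - cut x).
    by apply: all_momentsB => //; exact: all_moments_cst.
  rewrite -meanZ//; apply: norm_mean_le; [exact: all_momentsB|exact: all_momentsZ|].
  move=> x; rewrite -{1}(mulr1 (phi x)) -mulrBr normrM (@ger0_norm _ (1 - _)).
    by rewrite ler_wpM2r// subr_ge0 cutoff_le1.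
  by rewrite subr_ge0 cutoff_le1.
have eps6 : 0 < eps / 6 by rewrite divr_gt0.
have /cvgrPdist_le/(_ _ eps6) psiY := psi_cvg psi (L + 1) cpsi psi0 mean_psi.
near=> N.
have psiYN : `|0 - \int[P N]_w psi (Y N w)| <= eps / 6.
  by near: N; exact: psiY.
have YVN : \int[P N]_w Y N w ^+ 2 <= V by near: N.
have aN := acut N; have phN := aphi N; have YN := aY N.
pose cN := \int[P N]_w cut (Y N w).
have cN1 : cN <= 1.
  rewrite -(mean_cst (P N) 1); apply: mean_le => //; first exact: all_moments_cst.
  by move=> w; exact: cutoff_le1.
have c1 : c <= 1.
  rewrite -(mean_cst nu 1); apply: mean_le => //; first exact: all_moments_cst.
  by move=> w; exact: cutoff_le1.
have a1N : all_moments (P N) (fun w => 1 - cut (Y N w)).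
  by apply: all_momentsB => //; exact: all_moments_cst.
have cN_near : 1 - cN <= e.
  rewrite -(mean_cst (P N) 1) -meanB//; last exact: all_moments_cst.
  apply: (@le_trans _ _ (\int[P N]_w (L ^- 2 * Y N w ^+ 2))).
    apply: mean_le => //; first by apply: all_momentsZ; exact: all_momentsX.
    by move=> w; rewrite mulrC subr1_cutoff_le.
  rewrite meanZ; last exact: all_momentsX.
  by rewrite (le_trans _ VL)// mulrC ler_wpM2r// invr_ge0 sqr_ge0.
have tailN : `|\int[P N]_w phi (Y N w) - \int[P N]_w (phi (Y N w) * cut (Y N w))| <= M * (1 - cN).
  rewrite -meanB//; last exact: all_momentsM.
  rewrite -(mean_cst (P N) 1) -meanB//; last exact: all_moments_cst.
  rewrite -meanZ//; apply: norm_mean_le; [|exact: all_momentsZ|].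
    by apply: all_momentsB => //; exact: all_momentsM.
  move=> w; rewrite -{1}(mulr1 (phi _)) -mulrBr normrM (@ger0_norm _ (1 - _)).
    by rewrite ler_wpM2r// subr_ge0 cutoff_le1.
  by rewrite subr_ge0 cutoff_le1.
have mean_psiN : \int[P N]_w psi (Y N w) =
    \int[P N]_w (phi (Y N w) * cut (Y N w)) - b / c * cN.
  rewrite /psi meanB ?meanZ//; [exact: all_momentsM|exact: all_momentsZ].
(* [c] and [cN] both lie in [[1 - e, 1]]. *)
have bcc : `|b / c * (cN - c)| <= M * e.
  rewrite normrM ler_pM// ler_norml; rewrite -/cut -/c in c_near; lra.
have bE : b = b / c * c by rewrite divfK// gt_eqF.
have Mc : M * (1 - c) <= M * e by rewrite ler_wpM2l// ltW.
have McN : M * (1 - cN) <= M * e by rewrite ler_wpM2l.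
move: psiYN tail tailN bcc; rewrite mean_psiN !ler_norml => /andP[p1 p2] /andP[t1 t2] /andP[n1 n2].
rewrite mulrBr -bE => /andP[b1 b2].
have Me : M * e <= eps / 6 by rewrite mulrDl mul1r in eeps; lra.
apply/andP; split; lra.
Unshelve. all: by end_near. Qed.

End Cutoff.

(** * A central limit theorem for quadratic forms *)

(** Serves to fix the precision [e] of a modulus of continuity, and with it the constant [C], before
    [N] tends to infinity. *)
Lemma cvg0_le_addl (R : realType) (a : nat -> R) :
  (forall e, 0 < e -> exists2 u : nat -> R, u N @[N --> \oo] --> (0 : R) &
     forall N, `|a N| <= e + u N) ->
  a N @[N --> \oo] --> (0 : R).
Proof.
move=> H; apply/cvgrPdist_le => eps eps0.
have e2 : 0 < eps / 2 by rewrite divr_gt0.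
have [u u0 au] := H _ e2.
move/cvgrPdist_le: u0 => /(_ _ e2) u0; near=> N.
have uN : `|0 - u N| <= eps / 2 by near: N.
rewrite sub0r normrN (le_trans (au N))//.
by move: uN; rewrite sub0r normrN ler_norml => /andP[_]; lra.
Unshelve. all: by end_near. Qed.

Section QuadraticCLT.
Context (R : realType) (d : nat -> measure_display).
Context (T : forall N, measurableType (d N)) (P : forall N, probability (T N) R).
Unset Implicit Arguments.
Variables (I : nat -> finType) (X : forall N, I N -> {RV (P N) >-> R}).
Variables (v : forall N, I N -> R) (A : R).
Hypothesis X_indep : forall N, independent_on (P N) predT (X N).
Hypothesis X_moments : forall N a, all_moments (P N) (X N a).
Hypothesis X_mean : forall N a, \int[P N]_w X N a w = 0.
Hypothesis X_var : forall N a, \int[P N]_w X N a w ^+ 2 = v N a.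
Hypothesis v_le : forall N a, v N a <= A.
Hypothesis X_fourth : forall N a, \int[P N]_w X N a w ^+ 4 <= A ^+ 2.

Variables (K : forall N, I N -> I N -> R) (kap rho : nat -> R).
Hypothesis KC : forall N a b, K N a b = K N b a.
Hypothesis kap_ge0 : forall N, 0 <= kap N.
Hypothesis rho_ge0 : forall N, 0 <= rho N.
Hypothesis K_le : forall N a b, `|K N a b| <= kap N.
Hypothesis K_row : forall N a, \sum_b `|K N a b| <= rho N.

Local Notation n N := (#|I N|%:R : R).

Variables (c sigma2 : R).
Hypothesis sigma2_ge0 : 0 <= sigma2.
(** The four rates have separate roles: [n * kap * rho] bounds the mean square of the form and the
    [eps] part of Stein's identity, [n * kap ^ 2] removes the diagonal, [n * (kap * rho) ^ 2] the
    quadratic part of the Taylor remainder, and [n * kap * rho ^ 3] the fluctuation of the inner sum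
    [Tvar] about its mean. *)
Hypothesis nkr_le : forall N, n N * (kap N * rho N) <= c.
Hypothesis nk2_cvg : n N * kap N ^+ 2 @[N --> \oo] --> (0 : R).
Hypothesis nkr2_cvg : n N * (kap N * rho N) ^+ 2 @[N --> \oo] --> (0 : R).
Hypothesis nkr3_cvg : n N * (kap N * rho N ^+ 3) @[N --> \oo] --> (0 : R).
Hypothesis var_cvg : 2 * (\sum_p K N p.1 p.2 ^+ 2 * (v N p.1 * v N p.2)) @[N --> \oo] --> sigma2.

Let Koff N a b := if a == b then 0 else K N a b.
Let Kdiag N a b := if a == b then K N a b else 0.

Let qform_split N w :
  qform (X N) (v N) (K N) w =
  qform (X N) (v N) (Koff N) w + qform (X N) (v N) (Kdiag N) w.
Proof.
rewrite /qform -big_split; apply: eq_bigr => p _ /=.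
by rewrite -mulrDl /Koff /Kdiag; case: eqP; rewrite ?add0r ?addr0.
Qed.

Let sum_diag N : \sum_p Kdiag N p.1 p.2 ^+ 2 <= n N * kap N ^+ 2.
Proof.
rewrite -(pair_bigA _ (fun a b => Kdiag N a b ^+ 2)) /=.
rewrite mulr_natl -sumr_const; apply: ler_sum => a _.
rewrite (bigD1 a)//= big1 => [|b ba]; last first.
  by rewrite /Kdiag eq_sym (negbTE ba) expr0n.
by rewrite addr0 /Kdiag eqxx -(real_normK (num_real _)) lerXn2r ?nnegrE.
Qed.

Let A_ge0 N (a : I N) : 0 <= A.
Proof. by rewrite (le_trans _ (v_le N a))// (v_ge0 (X_var N)). Qed.

Let var_off N :=
  2 * (\sum_p Koff N p.1 p.2 ^+ 2 * (v N p.1 * v N p.2)).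

(** Deleting the diagonal changes the variance by at most [2 * A ^ 2 * n * kap ^ 2]. *)
Let var_off_cvg : var_off N @[N --> \oo] --> sigma2.
Proof.
have : (2 * (\sum_p K N p.1 p.2 ^+ 2 * (v N p.1 * v N p.2)) - var_off N)
    @[N --> \oo] --> (0 : R).
  apply: cvg0_le_addl => e e0.
  exists (fun N => 2 * A ^+ 2 * (n N * kap N ^+ 2)).
    by rewrite -[X in _ --> X](mulr0 (2 * A ^+ 2)); apply: cvgM => //; exact: cvg_cst.
  move=> N; rewrite /var_off -mulrBr -sumrB.
  rewrite (eq_bigr (fun p => Kdiag N p.1 p.2 ^+ 2 * (v N p.1 * v N p.2))); last first.
    move=> p _; rewrite -mulrBl; congr (_ * _); rewrite /Koff /Kdiag.
    by case: ifP; rewrite expr0n ?subr0 ?subrr.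
  have vv p : 0 <= v N p.1 * v N p.2 by rewrite mulr_ge0// (v_ge0 (X_var N)).
  rewrite ger0_norm; last first.
    by rewrite mulr_ge0// sumr_ge0// => p _; rewrite mulr_ge0// sqr_ge0.
  rewrite (le_trans (y := 2 * A ^+ 2 * (n N * kap N ^+ 2)))//; last by rewrite lerDr ltW.
  rewrite -mulrA ler_pM2l//; apply: le_trans (_ : A ^+ 2 * \sum_p Kdiag N p.1 p.2 ^+ 2 <= _).
    rewrite mulr_sumr; apply: ler_sum => p _; rewrite mulrC ler_wpM2r ?sqr_ge0//.
    by rewrite expr2 ler_pM ?(v_ge0 (X_var N)).
  by rewrite ler_wpM2l ?sqr_ge0.
move=> h.
rewrite -[sigma2]subr0 (_ : var_off = fun N =>
  2 * (\sum_p K N p.1 p.2 ^+ 2 * (v N p.1 * v N p.2)) -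
  (2 * (\sum_p K N p.1 p.2 ^+ 2 * (v N p.1 * v N p.2)) - var_off N)).
  exact: cvgB.
by apply/funext => N; rewrite subKr.
Qed.

Let Koff_sym N a b : Koff N a b = Koff N b a.
Proof. by rewrite /Koff eq_sym KC. Qed.

Let Koff0 N a : Koff N a a = 0.
Proof. by rewrite /Koff eqxx. Qed.

Let norm_Koff N a b : `|Koff N a b| <= `|K N a b|.
Proof. by rewrite /Koff; case: ifP; rewrite ?normr0. Qed.

Let Koff_le N a b : `|Koff N a b| <= kap N.
Proof. exact: le_trans (norm_Koff _ _ _) (K_le _ _ _). Qed.

Let Koff_row N a : \sum_b `|Koff N a b| <= rho N.
Proof. by apply: le_trans (K_row N a); apply: ler_sum => b _; exact: norm_Koff. Qed.

Let Zoff N := qform (X N) (v N) (Koff N).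

Let all_moments_Zoff N : all_moments (P N) (Zoff N).
Proof. exact: all_moments_qform. Qed.

Let cvg_stein (F G : R -> R) L : (forall x : R, is_derive x 1 F (G x)) ->
  continuous G -> vanishes_off L F -> vanishes_off L G ->
  (\int[P N]_w (Zoff N w * F (Zoff N w)) -
    var_off N * \int[P N]_w G (Zoff N w)) @[N --> \oo] --> (0 : R).
Proof.
move=> FG cG F0 G0.
have cF : continuous F.
  by move=> x; apply: differentiable_continuous; apply/derivable1_diffP; case: (FG x).
have [MF FM] := csupp_bounded cF F0; have [MG GM] := csupp_bounded cG G0.
pose M := Num.max MF MG.
have M0 : 0 <= M by rewrite /M le_max (le_trans (normr_ge0 _) (FM 0)).
have FM' x : `|F x| <= M by rewrite /M le_max FM.
have GM' x : `|G x| <= M by rewrite /M le_max GM orbT.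
apply: cvg0_le_addl => e e0.
have c0 : 0 <= c by rewrite (le_trans _ (nkr_le 0%N))// !mulr_ge0.
(* Two errors do not vanish as [N] grows: [4 * eta * A ^ 2 * c] from the modulus of [G], and
   [M * eta] from the fluctuation of [Tvar]. The same [eta] serves in both, and [eta * D = e] covers
   their sum; the summand 1 keeps [D] positive. *)
pose D := 4 * A ^+ 2 * c + M + 1.
have Ac0 : 0 <= 4 * A ^+ 2 * c by rewrite mulr_ge0// mulr_ge0// sqr_ge0.
have D0 : 0 < D by rewrite /D; lra.
pose eta := e / D.
have eta0 : 0 < eta by rewrite divr_gt0.
have [C C0 Gm] := csupp_modulus cG G0 eta0.
have Ft := taylor1_modulus FG C0 Gm.
exists (fun N => 96 * C * A ^+ 4 * (n N * (kap N * rho N) ^+ 2) +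
   M * eta^-1 * (8 * A ^+ 4) * (n N * (kap N * rho N ^+ 3))).
  rewrite -[X in _ --> X]addr0; apply: cvgD.
    by rewrite -[X in _ --> X](mulr0 (96 * C * A ^+ 4)); apply: cvgM => //; exact: cvg_cst.
  by rewrite -[X in _ --> X](mulr0 (M * eta^-1 * (8 * A ^+ 4))); apply: cvgM => //; exact: cvg_cst.
move=> N.
have mF := continuous_measurable_fun cF; have mG := continuous_measurable_fun cG.
have := stein_estimate (X_indep N) (X_moments N) (X_mean N) (X_var N)
  (v_le N) (X_fourth N) (Koff_sym N) (Koff0 N)
  (Koff_le N) (Koff_row N) mF mG FM' GM' (ltW eta0) C0 Ft Gm eta0.
move=> /le_trans; apply.
have e_eta : e = eta * D by rewrite /eta divfK// gt_eqF.
have le1 : 4 * eta * A ^+ 2 * (n N * (kap N * rho N)) <= 4 * eta * A ^+ 2 * c.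
  by rewrite ler_wpM2l// mulr_ge0 ?sqr_ge0// mulr_ge0// ltW.
rewrite e_eta /D.
have -> : eta * (4 * A ^+ 2 * c + M + 1) = 4 * eta * A ^+ 2 * c + M * eta + eta by ring.
move: le1; set t1 := _ * c; rewrite !mulrDr => le1; lra.
Qed.

Let cvg_psi_off (psi : R -> R) L : continuous psi -> vanishes_off L psi ->
  \int[normal_law 0 sigma2]_x psi x = 0 ->
  \int[P N]_w psi (Zoff N w) @[N --> \oo] --> (0 : R).
Proof.
move=> cpsi psi0; rewrite /normal_law.
have mpsi := continuous_measurable_fun cpsi.
have [s0|s0] := eqVneq sigma2 0.
  (* In the degenerate case the mean of [psi] is [psi 0], so [|psi z| <= e + C * z ^ 2], and the
     mean square of the form, at most [var_off], tends to 0. *)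
  rewrite /Rintegral integral_dirac//; last exact/measurable_EFinP.
  rewrite diracT mul1e /= => psi00.
  apply: cvg0_le_addl => e e0.
  have [C C0 psim] := csupp_modulus cpsi psi0 e0.
  exists (fun N => C * var_off N).
    by rewrite -(mulr0 C) -[X in C * X]s0; apply: cvgM => //; exact: cvg_cst.
  move=> N; apply: (@le_trans _ _ (\int[P N]_w (e + C * Zoff N w ^+ 2))).
    apply: norm_mean_le.
    - have [M psiM] := csupp_bounded cpsi psi0.
      apply: (@all_moments_bounded _ _ _ _ _ M) => //.
      by apply: measurableT_comp => //; case: (all_moments_Zoff N).
    - by have := all_moments_Zoff; moments.
    - by move=> w; have := psim 0 (Zoff N w); rewrite add0r psi00 subr0.
  rewrite meanD ?mean_cst ?meanZ; try by have := all_moments_Zoff; moments.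
  rewrite lerD2l ler_wpM2l//.
  exact: mean_sqr_qform_off_diag_le.
have s_gt0 : 0 < Num.sqrt sigma2 by rewrite sqrtr_gt0 lt0r s0.
move=> /(stein_solution s_gt0 cpsi psi0)[F [G [FG cG F0 G0 psiE]]].
have cF : continuous F.
  by move=> x; apply: differentiable_continuous; apply/derivable1_diffP; case: (FG x).
have [MF FM] := csupp_bounded cF F0; have [MG GM] := csupp_bounded cG G0.
have aF N : all_moments (P N) (fun w => F (Zoff N w)).
  apply: (@all_moments_bounded _ _ _ _ _ MF) => //; apply: measurableT_comp.
    exact: continuous_measurable_fun.
  by case: (all_moments_Zoff N).
have aG N : all_moments (P N) (fun w => G (Zoff N w)).
  apply: (@all_moments_bounded _ _ _ _ _ MG) => //; apply: measurableT_comp.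
    exact: continuous_measurable_fun.
  by case: (all_moments_Zoff N).
(* Stein's equation turns [psi] into [sigma2 * G - z * F]. Once [var_off * G] is added and
   subtracted, one part vanishes because [var_off] tends to [sigma2] and [G] is bounded, the other
   by [cvg_stein]. *)
rewrite (_ : (fun N => _) = fun N => (sigma2 - var_off N) * \int[P N]_w G (Zoff N w) -
   (\int[P N]_w (Zoff N w * F (Zoff N w)) - var_off N * \int[P N]_w G (Zoff N w))); last first.
  apply/funext => N.
  rewrite (_ : \int[P N]_w psi (Zoff N w) =
    \int[P N]_w (sigma2 * G (Zoff N w) - Zoff N w * F (Zoff N w))); last first.
    by apply: eq_Rintegral => w _; rewrite -psiE sqr_sqrtr.
  rewrite meanB ?meanZ; [ring| | |]; by have := all_moments_Zoff; moments.
rewrite -[X in _ --> X]subr0; apply: (cvgB _ (cvg_stein F G L FG cG F0 G0)).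
apply: cvg0_le_addl => e e0.
exists (fun N => `|sigma2 - var_off N| * MG).
  rewrite -[X in _ --> X](mul0r MG); apply: cvgM; last exact: cvg_cst.
  rewrite -(@normr0 R R) -(subrr sigma2); apply: cvg_norm.
  by apply: cvgB => //; exact: cvg_cst.
move=> N; rewrite normrM (le_trans (y := `|sigma2 - var_off N| * MG))//; last by rewrite lerDr ltW.
rewrite ler_wpM2l// -(mean_cst (P N) MG); apply: norm_mean_le => //.
exact: all_moments_cst.
Qed.

Set Implicit Arguments.
Theorem quadratic_clt :
  cvg_in_distribution P (fun N => qform (X N) (v N) (K N)) (normal_law 0 sigma2).
Proof.
have aY N : all_moments (P N) (qform (X N) (v N) (K N)) by exact: all_moments_qform.
apply: (@cvg_in_distribution_csupp _ _ _ _ _ _ (2 * A ^+ 2 * c)) => //.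
  (* The mean square is bounded uniformly in [N] by [nkr_le], since the squared entries of a row sum
     to at most [kap * rho]. *)
  near=> N; apply: le_trans (mean_sqr_qform_le (X_indep N) (X_moments N) (X_mean N)
    (X_var N) (v_le N) (X_fourth N) (KC N)) _.
  rewrite ler_wpM2l//; first by rewrite mulr_ge0// sqr_ge0.
  apply: le_trans (nkr_le N).
  rewrite -(pair_bigA _ (fun a b => K N a b ^+ 2)) /=.
  rewrite mulr_natl -sumr_const; apply: ler_sum => a _.
  apply: (@le_trans _ _ (\sum_b kap N * `|K N a b|)).
    by apply: ler_sum => b _; rewrite -real_normK ?num_real// expr2 ler_wpM2r.
  by rewrite -mulr_sumr ler_wpM2l.
move=> psi L cpsi psi0 mean0.
have mpsi := continuous_measurable_fun cpsi.
have [M psiM] := csupp_bounded cpsi psi0.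
have acomp N (g : T N -> R) : all_moments (P N) g -> all_moments (P N) (fun w => psi (g w)).
  move=> [mg _]; apply: (@all_moments_bounded _ _ _ _ _ M) => //.
  exact: measurableT_comp.
(* The off-diagonal form replaces the full one; the error is at most [e + C * t ^ 2] with [t] the
   diagonal part, whose mean square has order [n * kap ^ 2]. *)
rewrite (_ : (fun N => _) = fun N =>
  \int[P N]_w (psi (qform (X N) (v N) (K N) w) - psi (Zoff N w)) +
  \int[P N]_w psi (Zoff N w)); last first.
  by apply/funext => N; rewrite meanB ?subrK//; exact: acomp.
rewrite -[X in _ --> X]addr0; apply: (cvgD _ (cvg_psi_off psi L cpsi psi0 mean0)).
apply: cvg0_le_addl => e e0.
have [C C0 psim] := csupp_modulus cpsi psi0 e0.
exists (fun N => C * (2 * A ^+ 2) * (n N * kap N ^+ 2)).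
  by rewrite -[X in _ --> X](mulr0 (C * (2 * A ^+ 2))); apply: cvgM => //; exact: cvg_cst.
move=> N.
have aD : all_moments (P N) (qform (X N) (v N) (Kdiag N)) by exact: all_moments_qform.
have aCD : all_moments (P N) (fun w => C * qform (X N) (v N) (Kdiag N) w ^+ 2).
  by apply: all_momentsZ; exact: all_momentsX.
apply: (@le_trans _ _ (\int[P N]_w (e + C * qform (X N) (v N) (Kdiag N) w ^+ 2))).
  apply: norm_mean_le.
  - by apply: all_momentsB; exact: acomp.
  - by apply: all_momentsD => //; exact: all_moments_cst.
  - by move=> w; rewrite qform_split; exact: psim.
rewrite meanD ?mean_cst ?meanZ//; [|exact: all_momentsX|exact: all_moments_cst].
rewrite lerD2l -mulrA ler_wpM2l//.
have KdC a b : Kdiag N a b = Kdiag N b a by rewrite /Kdiag eq_sym KC.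
apply: le_trans (mean_sqr_qform_le (X_indep N) (X_moments N) (X_mean N)
    (X_var N) (v_le N) (X_fourth N) KdC) _.
by rewrite ler_wpM2l// mulr_ge0// sqr_ge0.
Unshelve. all: by end_near. Qed.

End QuadraticCLT.

(** * Riemann sums and the nonmeasurable Lebesgue integral *)

Section NonmeasurableIntegral.
Context d (T : measurableType d) (R : realType) (mu : {measure set T -> \bar R}).

(* Unlike [ge0_le_integral], no measurability: the integral of a nonnegative
   function is a supremum over the simple functions below it. *)
Lemma ge0_le_integral_sup (D : set T) (f g : T -> R) :
  (forall x, D x -> 0 <= f x) -> (forall x, D x -> f x <= g x) ->
  (\int[mu]_(x in D) (f x)%:E <= \int[mu]_(x in D) (g x)%:E)%E.
Proof.
move=> f0 fg.
have g0 x : D x -> 0 <= g x by move=> Dx; exact: le_trans (f0 _ Dx) (fg _ Dx).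
rewrite !ge0_integralE//.
apply: le_ereal_sup => _ [h hf <-]; exists h => // x.
apply: le_trans (hf x) _; rewrite !patchE; case: ifPn => //.
by rewrite inE lee_fin => /fg.
Qed.

Lemma integral_step (D : set T) (J : finType) (S : J -> set T) (k : J -> R) (m : R) :
  measurable D -> (forall c, measurable (S c)) -> (forall c, S c `<=` D) ->
  (forall c, mu (S c) = m%:E) -> (forall c, 0 <= k c) ->
  (\int[mu]_(x in D) (\sum_c k c * \1_(S c) x)%:E)%E = (\sum_c k c * m)%:E.
Proof.
move=> mD mS SD muS k0.
under eq_integral do rewrite -sumEFin.
rewrite ge0_integral_sum//; last 2 first.
- move=> c; apply/measurable_EFinP; apply: measurable_funM => //.
- by move=> c x _; rewrite lee_fin mulr_ge0// indicE.
rewrite -sumEFin; apply: eq_bigr => c _.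
under eq_integral do rewrite EFinM.
rewrite ge0_integralZl//.
- by rewrite integral_indic// setIidl// muS.
- exact/measurable_EFinP.
by rewrite lee_fin.
Qed.

End NonmeasurableIntegral.

(** * Oscillation on small cells and Riemann integrability *)

Section Oscillation.
Context (R : realType) (Z : Type).

Definition osc (g : Z -> R) (S : set Z) : R := sup (g @` S) - inf (g @` S).

Variables (g : Z -> R) (M : R).

Section Bounds.
Variable S : set Z.
Hypothesis S0 : S !=set0.
Hypothesis gM : forall z, S z -> `|g z| <= M.

Lemma has_sup_image : has_sup (g @` S).
Proof.
split; first exact: image_nonempty.
by exists M => _ [z Sz <-]; rewrite (le_trans (ler_norm _))// gM.
Qed.

Lemma has_inf_image : has_inf (g @` S).
Proof.
split; first exact: image_nonempty.
by exists (- M) => _ [z Sz <-]; rewrite lerNl (le_trans (ler_norm _))// normrN gM.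
Qed.

Lemma le_sup_image z : S z -> g z <= sup (g @` S).
Proof. by move=> Sz; apply: (ub_le_sup (proj2 has_sup_image)); exists z. Qed.

Lemma inf_image_le z : S z -> inf (g @` S) <= g z.
Proof. by move=> Sz; apply: (ge_inf (proj2 has_inf_image)); exists z. Qed.

Lemma sup_image_le K : (forall z, S z -> g z <= K) -> sup (g @` S) <= K.
Proof.
by move=> gK; apply: ge_sup => [|_ [z Sz <-]]; [exact: image_nonempty|exact: gK].
Qed.

Lemma le_inf_image K : (forall z, S z -> K <= g z) -> K <= inf (g @` S).
Proof.
by move=> gK; apply: lb_le_inf => [|_ [z Sz <-]]; [exact: image_nonempty|exact: gK].
Qed.

Lemma osc_le K : (forall y z, S y -> S z -> g y - g z <= K) -> osc g S <= K.
Proof.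
move=> gK; rewrite /osc lerBlDr; apply: sup_image_le => y Sy.
rewrite -lerBlDl; apply: le_inf_image => z Sz.
by have := gK _ _ Sy Sz; lra.
Qed.

Lemma osc_ge0 : 0 <= osc g S.
Proof.
by have [z Sz] := S0; have := le_sup_image Sz; have := inf_image_le Sz; rewrite /osc; lra.
Qed.

Lemma subr_le_osc y z : S y -> S z -> g y - g z <= osc g S.
Proof. by move=> /le_sup_image gy /inf_image_le gz; rewrite /osc lerB. Qed.

End Bounds.

(** Tags that nearly attain the supremum in each cell and tags that nearly attain the infimum give
    two sums within [eps] of [I]. The slack [2 * eta] per cell adds at most another [2 * eps], by
    the choice of [eta]. *)
Lemma sum_osc_le (J : finType) (S : J -> set Z) (m I eps : R) :
  (forall c, S c !=set0) -> (forall c z, S c z -> `|g z| <= M) -> 0 <= m -> 0 < eps ->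
  (forall z : J -> Z, (forall c, S c (z c)) -> `|\sum_c g (z c) * m - I| < eps) ->
  \sum_c osc g (S c) * m <= 4 * eps.
Proof.
move=> S0 gM m0 eps0 tags.
pose eta := eps / (#|J|%:R * m + 1).
have D0 : 0 < #|J|%:R * m + 1 by rewrite ltr_wpDl// mulr_ge0.
have eta0 : 0 < eta by rewrite divr_gt0.
have /choice[y yP] : forall c, exists y, S c y /\ sup (g @` S c) - eta < g y.
  move=> c; have [_ [y Sy <-] ?] := sup_adherent eta0 (has_sup_image (S0 c) (gM c)).
  by exists y.
have /choice[z zP] : forall c, exists z, S c z /\ g z < inf (g @` S c) + eta.
  move=> c; have [_ [z Sz <-] ?] := inf_adherent eta0 (has_inf_image (S0 c) (gM c)).
  by exists z.
have hy := tags y (fun c => (yP c).1); have hz := tags z (fun c => (zP c).1).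
apply: (@le_trans _ _ (\sum_c (g (y c) * m - g (z c) * m + 2 * eta * m))).
  apply: ler_sum => c _; rewrite -mulrBl -mulrDl ler_wpM2r// /osc.
  have := (yP c).2; have := (zP c).2; lra.
have le_eta : \sum_(c : J) 2 * eta * m <= 2 * eps.
  rewrite sumr_const -(mulr_natl (_ * m)) (_ : _ * _ = 2 * (eta * (#|J|%:R * m))); last by ring.
  by rewrite ler_pM2l// /eta mulrAC ler_pdivrMr// ler_pM2l// lerDl ler01.
rewrite big_split sumrB /=.
have := hy; have := hz; rewrite !ltr_norml => /andP[? ?] /andP[? ?]; lra.
Qed.

End Oscillation.

Section UniformGrid.
Context (R : realType).

Definition cell (N i : nat) : set R := `[i%:R / N%:R, i.+1%:R / N%:R]%classic.

Lemma grid_pt_cell N (i : 'I_N) : cell N i (grid_pt R i).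
Proof.
rewrite /cell /= in_itv /= lexx andbT ler_wpM2r ?invr_ge0//.
by rewrite ler_nat.
Qed.

Lemma cell_subset N (i : 'I_N) : cell N i `<=` `[0, 1]%classic.
Proof.
move=> x; rewrite /cell /= !in_itv /= => /andP[ix xi].
have N0 : 0 < N%:R :> R by rewrite ltr0n (leq_ltn_trans _ (ltn_ord i)).
rewrite (le_trans _ ix) ?divr_ge0// (le_trans xi)//.
by rewrite ler_pdivrMr// mul1r ler_nat.
Qed.

Lemma uniform_subdivision (n : nat) delta : n.+1%:R^-1 < delta ->
  subdivision delta n.+1 (fun i => i%:R / n.+1%:R : R).
Proof.
move=> nd; split => [||i _]; rewrite ?mul0r ?divff//.
rewrite ler_wpM2r ?invr_ge0 ?ler_nat//; split=> //.
by rewrite -mulrBl -natrB// subSnn mul1r.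
Qed.

Lemma near_mesh delta : 0 < delta -> \forall n \near \oo, (n.+1%:R^-1 : R) < delta.
Proof.
move=> d0; have := @cvg_harmonic R; move=> /cvgrPdist_lt/(_ _ d0).
apply: filterS => n; rewrite sub0r normrN ger0_norm//.
exact: harmonic_ge0.
Qed.

Lemma sum_osc_cvg (h : R -> R) H : riemann_integrable h ->
  (forall x, x \in `[0, 1] -> `|h x| <= H) ->
  \sum_(i < n.+1) osc h (cell n.+1 i) * n.+1%:R^-1 @[n --> \oo] --> (0 : R).
Proof.
move=> [I hI] hH; apply/cvgrPdist_le => eps eps0.
have [delta d0 hd] := hI (eps / 4) (divr_gt0 eps0 (ltr0n R 4)).
have := near_mesh d0; apply: filterS => n nd.
have c0 (i : 'I_n.+1) : cell n.+1 i !=set0 by exists (grid_pt R i); exact: grid_pt_cell.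
have hM (i : 'I_n.+1) z : cell n.+1 i z -> `|h z| <= H.
  by move=> /cell_subset; exact: hH.
rewrite sub0r normrN ger0_norm; last first.
  by apply: sumr_ge0 => i _; rewrite mulr_ge0 ?invr_ge0// (osc_ge0 (M := H))//; exact: hM.
rewrite [leRHS](_ : eps = 4 * (eps / 4)); last by field.
apply: (@sum_osc_le _ _ h H _ _ _ I) => //; first by rewrite divr_gt0.
move=> z zc.
(* [inord] extends the tags from ordinals to [nat]; below the bound it changes nothing. *)
have := hd n.+1 _ (fun i => z (inord i)) (uniform_subdivision nd).
rewrite (eq_bigr (fun i : 'I_n.+1 => h (z i) * n.+1%:R^-1)); last first.
  by move=> i _; rewrite inord_val -mulrBl -natrB// subSnn mul1r.
apply => i i_n; have := zc (inord i); rewrite /cell /= in_itv /= inordK//.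
Qed.

(** The tags that nearly attain the extremes of [f] are chosen cell by cell, so they depend on both
    indices, as [riemann_integrable2] allows. *)
Lemma sum_osc2_cvg (f : R -> R -> R) M : riemann_integrable2 f ->
  (forall x y, x \in `[0, 1] -> y \in `[0, 1] -> `|f x y| <= M) ->
  \sum_(c : 'I_n.+1 * 'I_n.+1)
    osc (fun z => f z.1 z.2) (cell n.+1 c.1 `*` cell n.+1 c.2) * (n.+1%:R^-1 ^+ 2)
  @[n --> \oo] --> (0 : R).
Proof.
move=> [I fI] fM; apply/cvgrPdist_le => eps eps0.
have [delta d0 fd] := fI (eps / 4) (divr_gt0 eps0 (ltr0n R 4)).
have := near_mesh d0; apply: filterS => n nd.
have c0 (c : 'I_n.+1 * 'I_n.+1) : cell n.+1 c.1 `*` cell n.+1 c.2 !=set0.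
  by exists (grid_pt R c.1, grid_pt R c.2); split; exact: grid_pt_cell.
have hM (c : 'I_n.+1 * 'I_n.+1) z : (cell n.+1 c.1 `*` cell n.+1 c.2) z ->
    `|f z.1 z.2| <= M.
  by move=> [/cell_subset z1 /cell_subset z2]; exact: fM.
rewrite sub0r normrN ger0_norm; last first.
  apply: sumr_ge0 => c _; rewrite mulr_ge0 ?sqr_ge0//.
  by rewrite (osc_ge0 (M := M))//; exact: hM.
rewrite [leRHS](_ : eps = 4 * (eps / 4)); last by field.
apply: (@sum_osc_le _ _ (fun z => f z.1 z.2) M _ _ _ I) => //.
  by rewrite divr_gt0.
move=> z zc.
have := fd n.+1 n.+1 _ _ (fun i j => (z (inord i, inord j)).1)
  (fun i j => (z (inord i, inord j)).2) (uniform_subdivision nd) (uniform_subdivision nd).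
rewrite pair_big /= (eq_bigr (fun c : 'I_n.+1 * 'I_n.+1 =>
   f (z c).1 (z c).2 * (n.+1%:R^-1 ^+ 2))); last first.
  move=> [i j] _ /=; rewrite !inord_val -!mulrBl -!natrB// !subSnn !mul1r.
  by rewrite expr2.
apply => i j i_n j_n; have [] := zc (inord i, inord j).
by rewrite /cell /= !in_itv /= !inordK.
Qed.

End UniformGrid.

Lemma dist_le_width (R : realDomainType) (l u a b : R) :
  l <= a -> a <= u -> l <= b -> b <= u -> `|a - b| <= u - l.
Proof. by rewrite ler_norml; lra. Qed.

(** * The triple integral as a limit of grid sums *)

Section TripleIntegral.
Context (R : realType) (f : R -> R -> R) (h : R -> R) (M H : R).
Hypothesis f_ge0 : forall x y : R, x \in `[0, 1] -> y \in `[0, 1] -> 0 <= f x y.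
Hypothesis f_le : forall x y : R, x \in `[0, 1] -> y \in `[0, 1] -> f x y <= M.
Hypothesis f_int : riemann_integrable2 f.
Hypothesis h_le : forall x : R, x \in `[0, 1] -> `|h x| <= H.
Hypothesis h_int : riemann_integrable h.

Local Notation mu := (@lebesgue_measure R).
Local Notation mu3 := ((mu \x mu) \x mu)%E.

Definition kernel3 (p : R * R * R) : R :=
  h p.1.1 ^+ 2 * f p.1.1 p.1.2 * f p.1.2 p.2 * h p.2 ^+ 2.

Let unit_cube : set (R * R * R) := (`[0, 1] `*` `[0, 1]) `*` `[0, 1].

Let f_norm x y : x \in `[0, 1] -> y \in `[0, 1] -> `|f x y| <= M.
Proof. by move=> x1 y1; rewrite ger0_norm ?f_ge0 ?f_le. Qed.

Let zero_in : (0 : R) \in `[0, 1].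
Proof. by rewrite in_itv /= lexx ler01. Qed.

Let M_ge0 : 0 <= M.
Proof. exact: le_trans (f_ge0 zero_in zero_in) (f_le zero_in zero_in). Qed.

Let H_ge0 : 0 <= H.
Proof. exact: le_trans (normr_ge0 _) (h_le zero_in). Qed.

Let h2_le x : x \in `[0, 1] -> h x ^+ 2 <= H ^+ 2.
Proof. by move=> x1; rewrite -(real_normK (num_real _)) lerXn2r ?nnegrE// h_le. Qed.

Let kernel3_ge0 p : unit_cube p -> 0 <= kernel3 p.
Proof.
move=> [[p1 p2] p3]; rewrite /kernel3.
apply: mulr_ge0; last exact: sqr_ge0.
apply: mulr_ge0; last exact: f_ge0.
by apply: mulr_ge0; [exact: sqr_ge0|exact: f_ge0].
Qed.

Let kernel3_le p : unit_cube p -> `|kernel3 p| <= H ^+ 4 * M ^+ 2.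
Proof.
move=> Cp; rewrite ger0_norm ?kernel3_ge0//; case: Cp => -[p1 p2] p3.
rewrite (_ : H ^+ 4 * M ^+ 2 = H ^+ 2 * M * M * H ^+ 2); last by ring.
have q1 : 0 <= h p.1.1 ^+ 2 * f p.1.1 p.1.2 by apply: mulr_ge0; [exact: sqr_ge0|exact: f_ge0].
have q2 : 0 <= h p.1.1 ^+ 2 * f p.1.1 p.1.2 * f p.1.2 p.2 by apply: mulr_ge0 => //; exact: f_ge0.
apply: ler_pM => //; [exact: sqr_ge0| |exact: h2_le].
apply: ler_pM => //; [exact: f_ge0| |exact: f_le].
by apply: ler_pM => //; [exact: sqr_ge0|exact: f_ge0|exact: h2_le|exact: f_le].
Qed.

Definition grid3 N (c : 'I_N * 'I_N * 'I_N) : R * R * R :=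
  (grid_pt R c.1.1, grid_pt R c.1.2, grid_pt R c.2).

Section FixedGrid.
Variable n : nat.
Local Notation N := n.+1.
Local Notation J := ('I_N * 'I_N * 'I_N)%type.
Local Notation m := (N%:R^-1 : R).

Let cube (c : J) : set (R * R * R) := (@cell R N c.1.1 `*` @cell R N c.1.2) `*` @cell R N c.2.

(** Closed boxes cover the unit cube and carry the upper step function, where overlaps only add
    nonnegative terms. Left-open boxes are disjoint and carry the lower one; they miss the points
    with a coordinate 0, where the bound is 0 and the kernel nonnegative. All boxes have the same
    measure. *)
Let ocell (i : nat) : set R := `]i%:R / N%:R, i.+1%:R / N%:R]%classic.
Let ocube (c : J) : set (R * R * R) := (ocell c.1.1 `*` ocell c.1.2) `*` ocell c.2.

Let grid3_cube c : cube c (grid3 c).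
Proof. by split; [split|]; exact: grid_pt_cell. Qed.

Let cube_subset c : cube c `<=` unit_cube.
Proof. by move=> p [[/cell_subset p1 /cell_subset p2] /cell_subset p3]. Qed.

Let ocube_subset c : ocube c `<=` cube c.
Proof.
have oc (i : 'I_N) x : ocell i x -> @cell R N i x.
  by rewrite /ocell /cell /= !in_itv /= => /andP[/ltW -> ->].
by move=> p [[/oc p1 /oc p2] /oc p3].
Qed.

Let mcell i : measurable (@cell R N i).
Proof. exact: measurable_itv. Qed.

Let mocell i : measurable (ocell i).
Proof. exact: measurable_itv. Qed.

Let measure_itv_cell b i :
  mu [set` Interval (BSide b (i%:R / N%:R)) (BRight (i.+1%:R / N%:R))] = m%:E.
Proof.
rewrite lebesgue_measure_itv /= lte_fin ltr_pM2r ?invr_gt0// ltr_nat leqnn.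
by rewrite -EFinB -mulrBl -natrB// subSnn mul1r.
Qed.

Let measure_box (A B C : set R) : measurable A -> measurable B -> measurable C ->
  mu A = m%:E -> mu B = m%:E -> mu C = m%:E ->
  mu3 ((A `*` B) `*` C) = (m ^+ 3)%:E.
Proof.
move=> mA mB mC muA muB muC.
rewrite product_measure1E//; last exact: measurableX.
transitivity (mu A * mu B * mu C)%E; first by congr (_ * _)%E; exact: product_measure1E.
by rewrite muA muB muC -!EFinM; congr EFin; ring.
Qed.

Let measure_cube c : mu3 (cube c) = (m ^+ 3)%:E.
Proof. by apply: measure_box; rewrite ?measure_itv_cell. Qed.

Let measure_ocube c : mu3 (ocube c) = (m ^+ 3)%:E.
Proof. by apply: measure_box; rewrite ?measure_itv_cell. Qed.

Let measurable_cube c : measurable (cube c).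
Proof. by apply: measurableX => //; exact: measurableX. Qed.

Let measurable_ocube c : measurable (ocube c).
Proof. by apply: measurableX => //; exact: measurableX. Qed.

Let measurable_unit_cube : measurable unit_cube.
Proof. by apply: measurableX => //; exact: measurableX. Qed.

Let cell_cover (x : R) : x \in `[0, 1] -> exists i : 'I_N, @cell R N i x.
Proof.
rewrite in_itv /= => /andP[x0 x1].
have [->|x_neq1] := eqVneq x 1.
  exists ord_max; rewrite /cell /= in_itv /= divff// lexx andbT.
  by rewrite ler_pdivrMr// mul1r ler_nat.
have x_lt1 : x < 1 by rewrite lt_neqAle x_neq1.
have xN0 : 0 <= x * N%:R by rewrite mulr_ge0.
have lt_N : (Num.truncn (x * N%:R) < N)%N.
  by rewrite truncn_lt_nat// gtr_pMl.
exists (Ordinal lt_N); rewrite /cell /= in_itv /=.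
rewrite ler_pdivrMr// ler_pdivlMr// truncn_le xN0 /=.
exact: ltW (truncnS_gt _).
Qed.

Let ocell_inj (i j : nat) x : ocell i x -> ocell j x -> i = j.
Proof.
rewrite /ocell /= !in_itv /= => /andP[ix xi] /andP[jx xj].
apply/eqP; rewrite eqn_leq; apply/andP; split; rewrite -ltnS.
- by have := lt_le_trans ix xj; rewrite ltr_pM2r ?invr_gt0// ltr_nat.
- by have := lt_le_trans jx xi; rewrite ltr_pM2r ?invr_gt0// ltr_nat.
Qed.

Let has_bound c p : cube c p -> `|kernel3 p| <= H ^+ 4 * M ^+ 2.
Proof. by move=> /cube_subset; exact: kernel3_le. Qed.

Let cube0 c : cube c !=set0.
Proof. by exists (grid3 c). Qed.

Let usum := \sum_c sup (kernel3 @` cube c) * m ^+ 3.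
Let lsum := \sum_c inf (kernel3 @` cube c) * m ^+ 3.
Definition grid_sum := \sum_(c : J) kernel3 (grid3 c) * m ^+ 3.

Let inf_ge0 c : 0 <= inf (kernel3 @` cube c).
Proof. by apply: le_inf_image => [|p /cube_subset] //; exact: kernel3_ge0. Qed.

Let integral_le_usum :
  (\int[mu3]_(p in unit_cube) (kernel3 p)%:E <= usum%:E)%E.
Proof.
have sup_ge0 c : 0 <= sup (kernel3 @` cube c).
  apply: le_trans _ (le_sup_image (cube0 c) (@has_bound c) (grid3_cube c)).
  by apply: kernel3_ge0; apply: cube_subset; exact: grid3_cube.
rewrite -(@integral_step _ _ _ mu3 unit_cube _ cube)//.
apply: ge0_le_integral_sup => [|p Cp]; first exact: kernel3_ge0.
case: (Cp) => -[/cell_cover[i pi] /cell_cover[j pj]] /cell_cover[l pl].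
have pc : cube (i, j, l) p by [].
rewrite (bigD1 (i, j, l))//= ler_wpDr//.
  by apply: sumr_ge0 => c _; rewrite mulr_ge0// indicE.
rewrite indicE mem_set// mulr1.
exact (le_sup_image (cube0 (i, j, l)) (@has_bound (i, j, l)) pc).
Qed.

Let lsum_le_integral :
  (lsum%:E <= \int[mu3]_(p in unit_cube) (kernel3 p)%:E)%E.
Proof.
rewrite -(@integral_step _ _ _ mu3 unit_cube _ ocube)//; last first.
  by move=> c p /ocube_subset/cube_subset.
apply: ge0_le_integral_sup => p Cp.
  by apply: sumr_ge0 => c _; rewrite mulr_ge0// indicE.
have [[c pc]|nc] := pselect (exists c, ocube c p).
  rewrite (bigD1 c)//= big1 => [|c' c'c].
    rewrite addr0 indicE mem_set// mulr1.
    exact (inf_image_le (cube0 c) (@has_bound c) (ocube_subset pc)).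
  rewrite indicE memNset ?mulr0// => -[[q1 q2] q3].
  move: pc => [[p1 p2] p3]; move/eqP: c'c; apply.
  case: c c' p1 p2 p3 q1 q2 q3 => [[i j] l] [[i' j'] l'] /= p1 p2 p3 q1 q2 q3.
  by congr (_, _, _); apply/val_inj; [exact: ocell_inj q1 p1|exact: ocell_inj q2 p2|exact: ocell_inj q3 p3].
rewrite big1 ?kernel3_ge0// => c _.
by rewrite indicE memNset ?mulr0// => pc; apply: nc; exists c.
Qed.

(** The four factors are exchanged one at a time. A factor [h ^ 2] changes by at most [2 * H] times
    the oscillation of [h], against [H ^ 2 * M ^ 2] for the other three; a factor [f] changes by at
    most its oscillation, against [H ^ 4 * M]. *)
Let osc_kernel3 c : osc kernel3 (cube c) <=
  2 * H ^+ 3 * M ^+ 2 * (osc h (@cell R N c.1.1) + osc h (@cell R N c.2)) +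
  H ^+ 4 * M * (osc (fun z => f z.1 z.2) (@cell R N c.1.1 `*` @cell R N c.1.2) +
                osc (fun z => f z.1 z.2) (@cell R N c.1.2 `*` @cell R N c.2)).
Proof.
apply: osc_le => // y z [[y1 y2] y3] [[z1 z2] z3].
have hosc (i : 'I_N) s t : @cell R N i s -> @cell R N i t ->
    h s ^+ 2 - h t ^+ 2 <= 2 * H * osc h (@cell R N i).
  move=> si ti; have hM u : @cell R N i u -> `|h u| <= H by move=> /cell_subset; exact: h_le.
  have i0 : @cell R N i !=set0 by exists s.
  have := subr_le_osc i0 hM si ti; have := subr_le_osc i0 hM ti si.
  have := hM _ si; have := hM _ ti; rewrite !ler_norml => /andP[? ?] /andP[? ?].
  rewrite subr_sqr; set o := osc _ _ => st ts.
  have : `|(h s - h t) * (h s + h t)| <= o * (2 * H).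
    by rewrite normrM ler_pM// ler_norml; lra.
  by rewrite ler_norml => /andP[_]; lra.
have fosc (i j : 'I_N) s t : (@cell R N i `*` @cell R N j) s -> (@cell R N i `*` @cell R N j) t ->
    f s.1 s.2 - f t.1 t.2 <= osc (fun z => f z.1 z.2) (@cell R N i `*` @cell R N j).
  move=> si ti; apply: (@subr_le_osc _ _ (fun z => f z.1 z.2) M) => //.
    by exists s.
  move=> u [/cell_subset u1 /cell_subset u2].
  exact: f_norm.
have d1 := hosc _ _ _ y1 z1; have d4 := hosc _ _ _ y3 z3.
have d2 := fosc c.1.1 c.1.2 (y.1.1, y.1.2) (z.1.1, z.1.2) (conj y1 y2) (conj z1 z2).
have d3 := fosc c.1.2 c.2 (y.1.2, y.2) (z.1.2, z.2) (conj y2 y3) (conj z2 z3).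
move: d1 d2 d3 d4 => /=.
move: (cell_subset y1) (cell_subset y2) (cell_subset y3) => y1' y2' y3'.
move: (cell_subset z1) (cell_subset z2) (cell_subset z3) => z1' z2' z3'.
have := h2_le y1'; have := h2_le y3'; have := h2_le z1'; have := h2_le z3'.
have := f_le y1' y2'; have := f_le y2' y3'; have := f_le z1' z2'; have := f_le z2' z3'.
have := f_ge0 y1' y2'; have := f_ge0 y2' y3'; have := f_ge0 z1' z2'; have := f_ge0 z2' z3'.
rewrite /kernel3.
have := sqr_ge0 (h y.1.1); have := sqr_ge0 (h y.2).
have := sqr_ge0 (h z.1.1); have := sqr_ge0 (h z.2).
set a := h y.1.1 ^+ 2; set b := f y.1.1 y.1.2; set e := f y.1.2 y.2; set g := h y.2 ^+ 2.
set a' := h z.1.1 ^+ 2; set b' := f z.1.1 z.1.2; set e' := f z.1.2 z.2; set g' := h z.2 ^+ 2.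
move=> g'0 a'0 g0 a0 e'0 b'0 e0 b0 e'M b'M eM bM g'H a'H gH aH.
set o1 := osc h _; set o2 := osc _ _; set o3 := osc _ _; set o4 := osc h _.
move=> d1 d2 d3 d4.
have o1_ge0 : 0 <= o1.
  apply: (@osc_ge0 _ _ h H) => [|u /cell_subset]; last exact: h_le.
  by exists (grid_pt R c.1.1); exact: grid_pt_cell.
have o4_ge0 : 0 <= o4.
  apply: (@osc_ge0 _ _ h H) => [|u /cell_subset]; last exact: h_le.
  by exists (grid_pt R c.2); exact: grid_pt_cell.
have f2_bound (i j : 'I_N) u : (@cell R N i `*` @cell R N j) u -> `|f u.1 u.2| <= M.
  by move=> [/cell_subset u1 /cell_subset u2]; exact: f_norm.
have o2_ge0 : 0 <= o2.
  apply: (@osc_ge0 _ _ (fun z => f z.1 z.2) M); last exact: f2_bound.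
  by exists (grid_pt R c.1.1, grid_pt R c.1.2); split; exact: grid_pt_cell.
have o3_ge0 : 0 <= o3.
  apply: (@osc_ge0 _ _ (fun z => f z.1 z.2) M); last exact: f2_bound.
  by exists (grid_pt R c.1.2, grid_pt R c.2); split; exact: grid_pt_cell.
have H20 : 0 <= H ^+ 2 by exact: sqr_ge0.
have -> : a * b * e * g - a' * b' * e' * g' =
  (a - a') * (b * e * g) + (b - b') * (a' * e * g) + (e - e') * (a' * b' * g) +
  (g - g') * (a' * b' * e') by ring.
have mul_le (x o k K : R) : x <= o -> 0 <= o -> 0 <= k -> k <= K -> x * k <= o * K.
  by move=> xo o0 k0 kK; apply: le_trans (ler_wpM2r k0 xo) (ler_wpM2l o0 kK).
have p3 (x y' z' X Y Z' : R) : 0 <= x -> 0 <= y' -> 0 <= z' -> x <= X -> y' <= Y -> z' <= Z' ->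
    0 <= x * y' * z' <= X * Y * Z'.
  by move=> *; apply/andP; split; [rewrite !mulr_ge0|rewrite ler_pM ?mulr_ge0// ler_pM].
have /andP[k1 k1'] := p3 _ _ _ _ _ _ b0 e0 g0 bM eM gH.
have /andP[k2 k2'] := p3 _ _ _ _ _ _ a'0 e0 g0 a'H eM gH.
have /andP[k3 k3'] := p3 _ _ _ _ _ _ a'0 b'0 g0 a'H b'M gH.
have /andP[k4 k4'] := p3 _ _ _ _ _ _ a'0 b'0 e'0 a'H b'M e'M.
have H2o1 : 0 <= 2 * H * o1 by rewrite mulr_ge0// mulr_ge0.
have H2o4 : 0 <= 2 * H * o4 by rewrite mulr_ge0// mulr_ge0.
have t1 := mul_le _ _ _ _ d1 H2o1 k1 k1'.
have t2 := mul_le _ _ _ _ d2 o2_ge0 k2 k2'.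
have t3 := mul_le _ _ _ _ d3 o3_ge0 k3 k3'.
have t4 := mul_le _ _ _ _ d4 H2o4 k4 k4'.
apply: le_trans (lerD (lerD (lerD t1 t2) t3) t4) _.
by rewrite le_eqVlt; apply/orP; left; apply/eqP; ring.
Qed.

(** Each index that [F] ignores contributes a factor [N], which cancels one [m]; likewise in the
    three variants that follow. *)
Let sum_first (F : 'I_N -> R) : \sum_(c : J) F c.1.1 * m ^+ 3 = \sum_i F i * m.
Proof.
rewrite -(pair_bigA _ (fun (q : 'I_N * 'I_N) (l : 'I_N) => F q.1 * m ^+ 3)) /=.
under eq_bigr do rewrite sumr_const card_ord.
rewrite -(pair_bigA _ (fun (i j : 'I_N) => F i * m ^+ 3 *+ N)) /=.
apply: eq_bigr => i _; rewrite sumr_const card_ord -mulrnA -[LHS]mulr_natr natrM.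
by field; rewrite ?pnatr_eq0.
Qed.

Let sum_last (F : 'I_N -> R) : \sum_(c : J) F c.2 * m ^+ 3 = \sum_i F i * m.
Proof.
rewrite -(pair_bigA _ (fun (q : 'I_N * 'I_N) (l : 'I_N) => F l * m ^+ 3)) /=.
rewrite sumr_const card_prod card_ord -[LHS]mulr_natr natrM mulr_suml.
by apply: eq_bigr => i _; field; rewrite ?pnatr_eq0.
Qed.

Let sum_first2 (F : 'I_N -> 'I_N -> R) :
  \sum_(c : J) F c.1.1 c.1.2 * m ^+ 3 = \sum_(q : 'I_N * 'I_N) F q.1 q.2 * m ^+ 2.
Proof.
rewrite -(pair_bigA _ (fun (q : 'I_N * 'I_N) (l : 'I_N) => F q.1 q.2 * m ^+ 3)) /=.
by apply: eq_bigr => q _; rewrite sumr_const card_ord -[LHS]mulr_natr; field; rewrite ?pnatr_eq0.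
Qed.

Let sum_last2 (F : 'I_N -> 'I_N -> R) :
  \sum_(c : J) F c.1.2 c.2 * m ^+ 3 = \sum_(q : 'I_N * 'I_N) F q.1 q.2 * m ^+ 2.
Proof.
rewrite -(pair_bigA _ (fun (q : 'I_N * 'I_N) (l : 'I_N) => F q.2 l * m ^+ 3)) /=.
rewrite -(pair_bigA _ (fun (i j : 'I_N) => \sum_l F j l * m ^+ 3)) /=.
rewrite sumr_const card_ord -[LHS]mulr_natr -(pair_bigA _ (fun i j => F i j * m ^+ 2)) /= mulr_suml.
apply: eq_bigr => i _; rewrite mulr_suml; apply: eq_bigr => l _.
by field; rewrite ?pnatr_eq0.
Qed.

(** The grid sum and the integral both lie between the lower and the upper sum, whose difference is
    a sum of oscillations. *)
Lemma grid_sum_near_integral :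
  `|grid_sum - \int[mu3]_(p in unit_cube) kernel3 p| <=
  2 * H ^+ 3 * M ^+ 2 * (2 * \sum_(i < N) osc h (@cell R N i) * m) +
  H ^+ 4 * M * (2 * \sum_(q : 'I_N * 'I_N)
    osc (fun z => f z.1 z.2) (@cell R N q.1 `*` @cell R N q.2) * m ^+ 2).
Proof.
(* An infinite integral would be sent to 0 by [fine]; the two finite bounds exclude this. *)
have : lsum <= \int[mu3]_(p in unit_cube) kernel3 p <= usum.
  rewrite /Rintegral; move: integral_le_usum lsum_le_integral.
  by case: (integral _ _ _) => [r||] //=; rewrite !lee_fin => -> ->.
move=> /andP[Il Iu].
have Sl : lsum <= grid_sum.
  apply: ler_sum => c _; rewrite ler_wpM2r ?exprn_ge0 ?invr_ge0//.
  exact (inf_image_le (cube0 c) (@has_bound c) (grid3_cube c)).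
have Su : grid_sum <= usum.
  apply: ler_sum => c _; rewrite ler_wpM2r ?exprn_ge0 ?invr_ge0//.
  exact (le_sup_image (cube0 c) (@has_bound c) (grid3_cube c)).
apply: le_trans (dist_le_width Sl Su Il Iu) _.
rewrite /usum /lsum -sumrB.
apply: (@le_trans _ _ (\sum_(c : J)
  (2 * H ^+ 3 * M ^+ 2 * (osc h (@cell R N c.1.1) * m ^+ 3 + osc h (@cell R N c.2) * m ^+ 3) +
  H ^+ 4 * M * (osc (fun z => f z.1 z.2) (@cell R N c.1.1 `*` @cell R N c.1.2) * m ^+ 3 +
                osc (fun z => f z.1 z.2) (@cell R N c.1.2 `*` @cell R N c.2) * m ^+ 3)))).
  apply: ler_sum => c _; rewrite -mulrBl -!mulrDl mulrA (mulrA (H ^+ 4 * M)) -mulrDl.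
  rewrite ler_wpM2r ?exprn_ge0 ?invr_ge0//; exact: osc_kernel3.
rewrite big_split /= -!mulr_sumr !big_split /=.
rewrite (sum_first (fun i => osc h (@cell R N i))) (sum_last (fun i => osc h (@cell R N i))).
rewrite (sum_first2 (fun i j => osc (fun z => f z.1 z.2) (@cell R N i `*` @cell R N j))).
rewrite (sum_last2 (fun i j => osc (fun z => f z.1 z.2) (@cell R N i `*` @cell R N j))).
by rewrite !mulr2n !(mulrDl _ _ _) !mul1r.
Qed.

End FixedGrid.

Lemma grid_sum_cvg :
  grid_sum n @[n --> \oo] --> \int[mu3]_(p in unit_cube) kernel3 p.
Proof.
apply/cvgrPdist_le => eps eps0.
have c1 := sum_osc_cvg h_int h_le.
have c2 := sum_osc2_cvg f_int f_norm.
have : (2 * H ^+ 3 * M ^+ 2 * (2 * \sum_(i < n.+1) osc h (@cell R n.+1 i) * n.+1%:R^-1) +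
  H ^+ 4 * M * (2 * \sum_(q : 'I_n.+1 * 'I_n.+1)
    osc (fun z => f z.1 z.2) (@cell R n.+1 q.1 `*` @cell R n.+1 q.2) * n.+1%:R^-1 ^+ 2))
  @[n --> \oo] --> 2 * H ^+ 3 * M ^+ 2 * (2 * 0) + H ^+ 4 * M * (2 * 0).
  apply: cvgD; (apply: cvgM; first exact: cvg_cst).
    by apply: cvgM c1; exact: cvg_cst.
  by apply: cvgM c2; exact: cvg_cst.
rewrite !mulr0 addr0 => /cvgrPdist_le/(_ _ eps0); apply: filterS => n.
rewrite sub0r normrN distrC; apply: le_trans.
by apply: le_trans (grid_sum_near_integral n) (ler_norm _).
Qed.

End TripleIntegral.

(** * The quadratic form as a sum over edges *)

Section Edges.
Variable N : nat.

(** The index set of the independent entries: unordered pairs with loops, each coded by its ordered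
    representative. *)
Definition edge := {p : 'I_N * 'I_N | (p.1 <= p.2)%N}.

Fact edge_of_subproof (j l : 'I_N) :
  ((Order.min j l, Order.max j l).1 <= (Order.min j l, Order.max j l).2)%N.
Proof.
have le_mM : (Order.min j l <= Order.max j l)%O by rewrite ge_min le_max lexx.
exact: le_mM.
Qed.

Definition edge_of (j l : 'I_N) : edge := Sub (Order.min j l, Order.max j l) (edge_of_subproof j l).

Lemma edge_ofC j l : edge_of j l = edge_of l j.
Proof. by apply: val_inj; rewrite /= minC maxC. Qed.

Lemma edge_of_eq j l j' l' :
  (edge_of j l == edge_of j' l') = ((j == j') && (l == l')) || ((j == l') && (l == j')).
Proof.
apply/eqP/idP => [[]|/orP[/andP[/eqP-> /eqP->]|/andP[/eqP-> /eqP->]]] //; last exact: edge_ofC.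
by case: (leP j l) => jl; case: (leP j' l') => jl' -> ->; rewrite !eqxx ?orbT.
Qed.

Lemma edge_of_inj j : injective (edge_of j).
Proof.
move=> l l' /eqP; rewrite edge_of_eq eqxx /= => /orP[/eqP//|/andP[/eqP <- /eqP //]].
Qed.

Lemma card_edge_le : (#|{: edge}| <= N ^ 2)%N.
Proof.
rewrite card_sig; apply: leq_trans (max_card _) _.
by rewrite card_prod card_ord mulnn.
Qed.

Context (R : realType).
Implicit Types (j l : 'I_N) (a b : edge).

(** Equals 1 if [j] is an end of [a] and 0 otherwise, because [edge_of j] is injective. Written as a
    sum, it is [coef] with all values of [x] equal to 1, so the two compare term by term. *)
Definition incidence j a : R := \sum_l (edge_of j l == a)%:R.

Lemma incidence_ge0 j a : 0 <= incidence j a.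
Proof. by apply: sumr_ge0 => l _. Qed.

Lemma incidence_le j a : incidence j a <= (j == (val a).1)%:R + (j == (val a).2)%:R.
Proof.
rewrite /incidence; have [[l la]|nl] := pselect (exists l, edge_of j l = a).
  rewrite (bigD1 l)//= la eqxx big1 ?addr0 => [|l' l'l]; last first.
    by rewrite -la (inj_eq (@edge_of_inj j)) (negbTE l'l).
  rewrite -la /= -natrD ler1n.
  by case: (leP j l) => _; rewrite eqxx ?addnS.
rewrite big1 ?addr_ge0// => l _.
by case: eqP => // la; case: nl; exists l.
Qed.

Lemma incidence_le1 j a : incidence j a <= 1.
Proof.
rewrite /incidence; have [[l la]|nl] := pselect (exists l, edge_of j l = a).
  rewrite (bigD1 l)//= la eqxx big1 ?addr0// => l' l'l.
  by rewrite -la (inj_eq (@edge_of_inj j)) (negbTE l'l).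
rewrite big1 ?ler01// => l _.
by case: eqP => // la; case: nl; exists l.
Qed.

Lemma sum_incidence_vertex a : \sum_j incidence j a <= 2.
Proof.
apply: le_trans (ler_sum _ (fun j _ => incidence_le j a)) _.
rewrite big_split /= (bigD1 (val a).1)//= big1 => [|j /negbTE -> //].
by rewrite (bigD1 (val a).2)//= big1 => [|j /negbTE -> //]; rewrite !eqxx !addr0.
Qed.

Lemma sum_edge_of (F : edge -> R) e : \sum_a (e == a)%:R * F a = F e.
Proof.
rewrite (bigD1 e)//= eqxx mul1r big1 ?addr0// => a.
by rewrite eq_sym => /negbTE ->; rewrite mul0r.
Qed.

Lemma sum_incidence_edge j : \sum_a incidence j a = N%:R.
Proof.
rewrite exchange_big /= (eq_bigr (fun=> 1)) => [|l _].
  by rewrite sumr_const card_ord.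
by rewrite -[RHS](sum_edge_of (fun=> 1) (edge_of j l)); apply: eq_bigr => a _; rewrite mulr1.
Qed.

Variables (x : 'I_N -> R) (H : R).
Hypothesis x_le : forall l, `|x l| <= H.

Let H_ge0 (l : 'I_N) : 0 <= H.
Proof. exact: le_trans (normr_ge0 _) (x_le l). Qed.

(** Equals [x l] if [a] joins [j] to [l], and 0 if [j] is no end of [a]; thus coordinate [j] of
    [W x] is [\sum_a coef j a * X a]. *)
Definition coef j a : R := \sum_l x l * (edge_of j l == a)%:R.

Lemma norm_coef_le j a : `|coef j a| <= H * incidence j a.
Proof.
rewrite /coef /incidence mulr_sumr; apply: le_trans (ler_norm_sum _ _ _) (ler_sum _ _) => l _.
by rewrite normrM normr_nat ler_wpM2r.
Qed.

(* With [x l] the values of [h] on the grid, [N * (e' W^2 e)] is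
   [\sum_j (\sum_a coef j a * X a) ^ 2 = \sum_(a, b) gram a b * X a * X b]. *)
Definition gram a b : R := \sum_j coef j a * coef j b.

Lemma gramC a b : gram a b = gram b a.
Proof. by apply: eq_bigr => j _; rewrite mulrC. Qed.

Let norm_gram_le_sum a b :
  `|gram a b| <= H ^+ 2 * \sum_j incidence j a * incidence j b.
Proof.
rewrite mulr_sumr; apply: le_trans (ler_norm_sum _ _ _) (ler_sum _ _) => j _.
rewrite normrM expr2 mulrACA; apply: ler_pM => //; exact: norm_coef_le.
Qed.

Lemma norm_gram_le a b : `|gram a b| <= 2 * H ^+ 2.
Proof.
apply: le_trans (norm_gram_le_sum a b) _; rewrite mulrC ler_wpM2r ?sqr_ge0//.
apply: le_trans (sum_incidence_vertex a); apply: ler_sum => j _.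
by rewrite ler_piMr ?incidence_ge0 ?incidence_le1.
Qed.

(** [a] has at most two ends, and each vertex lies on exactly [N] edges, its loop included. *)
Lemma sum_norm_gram_le a : \sum_b `|gram a b| <= 2 * H ^+ 2 * N%:R.
Proof.
apply: le_trans (ler_sum _ (fun b _ => norm_gram_le_sum a b)) _.
rewrite -mulr_sumr exchange_big /=.
rewrite [leRHS](_ : _ = H ^+ 2 * (2 * N%:R)); last by ring.
rewrite ler_wpM2l ?sqr_ge0//.
apply: (@le_trans _ _ (\sum_j incidence j a * N%:R)).
  by apply: ler_sum => j _; rewrite -mulr_sumr sum_incidence_edge.
by rewrite -mulr_suml ler_wpM2r// sum_incidence_vertex.
Qed.

Variables (v : edge -> R) (A : R).
Hypothesis v_ge0 : forall a, 0 <= v a.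
Hypothesis v_le : forall a, v a <= A.

(** If [v] gives the variances of independent centred entries, this is the covariance of coordinates
    [j] and [j'] of [W x]. *)
Definition overlap j j' : R := \sum_a coef j a * coef j' a * v a.

(** With [C] the matrix [coef] and [V] the diagonal matrix of [v], this is
    [tr ((C' C V) ^ 2) = tr ((C V C') ^ 2)]: a sum over pairs of edges becomes one over pairs of
    vertices. *)
Lemma sum_gram_sqr :
  \sum_p gram p.1 p.2 ^+ 2 * (v p.1 * v p.2) = \sum_j \sum_j' overlap j j' ^+ 2.
Proof.
rewrite (eq_bigr (fun p : edge * edge => \sum_j \sum_j'
   (coef j p.1 * coef j' p.1 * v p.1) * (coef j p.2 * coef j' p.2 * v p.2))); last first.
  move=> p _; rewrite /gram expr2 big_distrlr /= mulr_suml; apply: eq_bigr => j _.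
  by rewrite mulr_suml; apply: eq_bigr => j' _; ring.
rewrite exchange_big /=; apply: eq_bigr => j _.
rewrite exchange_big /=; apply: eq_bigr => j' _.
by rewrite /overlap expr2 big_distrlr pair_big.
Qed.

Lemma overlapE j j' : overlap j j' =
  \sum_l \sum_l' x l * x l' * v (edge_of j l) * (edge_of j' l' == edge_of j l)%:R.
Proof.
rewrite /overlap (eq_bigr (fun a => \sum_l \sum_l'
  (edge_of j l == a)%:R * (x l * x l' * v a * (edge_of j' l' == a)%:R))); last first.
  move=> a _; rewrite /coef big_distrlr /= mulr_suml; apply: eq_bigr => l _.
  by rewrite mulr_suml; apply: eq_bigr => l' _; ring.
rewrite exchange_big /=; apply: eq_bigr => l _.
rewrite exchange_big /=; apply: eq_bigr => l' _.
exact: (sum_edge_of (fun a => x l * x l' * v a * (edge_of j' l' == a)%:R)).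
Qed.

Lemma overlap_diag j : overlap j j = \sum_l x l ^+ 2 * v (edge_of j l).
Proof.
rewrite overlapE; apply: eq_bigr => l _.
rewrite (bigD1 l)//= eqxx mulr1 big1 ?addr0 ?expr2// => l' l'l.
by rewrite (inj_eq (@edge_of_inj j)) (negbTE l'l) mulr0.
Qed.

(** Distinct vertices have exactly one common edge, the one joining them, so a single term of the
    double sum survives. *)
Lemma norm_overlap_le j j' : j != j' -> `|overlap j j'| <= H ^+ 2 * A.
Proof.
move=> jj'; rewrite overlapE (bigD1 j')//= (bigD1 j)//=.
rewrite [X in _ + X]big1 ?addr0 => [|l lj']; last first.
  rewrite big1// => l' _; rewrite edge_of_eq (eq_sym j' j) (negbTE jj') /=.
  by rewrite eq_sym (negbTE lj') mulr0.
rewrite [X in _ + X]big1 ?addr0 => [|l' l'j]; last first.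
  by rewrite edge_of_eq (eq_sym j' j) (negbTE jj') /= (negbTE l'j) andbF mulr0.
rewrite edge_ofC eqxx mulr1 !normrM (ger0_norm (v_ge0 _)) expr2.
by rewrite ler_pM ?mulr_ge0// ler_pM.
Qed.

End Edges.

(** * Translation of the hypotheses and of the statistic to edges *)

Lemma independent_on_sig d (T : measurableType d) (R : realType)
    (P : probability T R) (I : finType) (D : pred I) (X : I -> T -> R) :
  independent_on P D X ->
  independent_on P predT (fun a : {i | D i} => X (val a)).
Proof.
move=> XD J A _ mA.
(* Off the subtype the value is a default: only indices in the image of [J] occur. *)
pose B i := if insub i is Some a then A a else setT.
have Bval a : B (val a) = A a by rewrite /B valK.
have -> : \bigcap_(a in [set` J]) X (val a) @^-1` A a =
    \bigcap_(i in [set` [set val a | a in J]%SET]) X i @^-1` B i.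
  apply/seteqP; split=> w Xw.
    by move=> i /= /imsetP[a aJ ->]; rewrite Bval; exact: Xw.
  by move=> a /= aJ; rewrite -Bval; apply: Xw => /=; exact: imset_f.
rewrite XD.
- rewrite big_imset /=; last by move=> a b _ _; exact: val_inj.
  by apply: eq_bigr => a _; rewrite Bval.
- by apply/fintype.subsetP => i /imsetP[a _ ->]; exact: valP.
- by move=> i /imsetP[a aJ ->]; rewrite Bval; exact: mA.
Qed.

Section Moments.
Context d (T : measurableType d) (R : realType) (P : probability T R).
Variable X : {RV P >-> R}.

Lemma mean_expectation (g : T -> R) : \int[P]_w g w = fine 'E_P[g].
Proof. by rewrite unlock. Qed.

Lemma all_moments_expectation (b : nat -> R) :
  (forall m, (1 <= m)%N -> ('E_P[fun w => (`|X w| ^+ m)%R] <= (b m)%:E)%E) ->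
  all_moments P X.
Proof.
move=> Xb; split=> // -[|m].
  by under eq_fun do rewrite expr0; exact: (finite_measure_integrable_cst P 1).
apply/integrableP; split.
  apply/measurable_EFinP; apply: measurable_funX; exact: measurableT_comp.
have := Xb m.+1 isT; rewrite unlock => Xm; apply: le_lt_trans (ltry (b m.+1)).
apply: le_trans Xm; rewrite le_eqVlt; apply/orP; left; apply/eqP.
by apply: eq_integral => w _; rewrite gee0_abs// lee_fin exprn_ge0.
Qed.

Lemma mean_sqr_variance v : ('E_P[X] = 0)%E -> 'V_P[X]%E = v%:E ->
  \int[P]_w X w ^+ 2 = v.
Proof.
move=> X0; rewrite /variance unlock X0 /= => Xv.
rewrite mean_expectation -[RHS]/(fine v%:E) -Xv; congr (fine 'E_P[_]).
apply/funext => w /=; rewrite -[RHS]/((X w - 0) * (X w - 0)); by rewrite subr0 expr2.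
Qed.

End Moments.

(** For symmetric [W], [e' W ^ 2 e] is the squared length of [W e], hence a sum of squares over
    vertices. *)
Lemma quad_form2E (R : realType) N (e : 'cV[R]_N) (W : 'M[R]_N) : W^T = W ->
  quad_form2 e W = \sum_j (\sum_l W j l * e l 0) ^+ 2.
Proof.
move=> WT; rewrite /quad_form2 mulmxA -mulmxA mxE; apply: eq_bigr => j _.
rewrite !mxE expr2; congr (_ * _); apply: eq_bigr => l _.
by rewrite mxE mulrC -{1}WT mxE.
Qed.

Lemma cvg0_le_inv (R : realType) (a : nat -> R) (C : R) :
  (forall N, 0 <= a N <= C * N%:R^-1) -> a N @[N --> \oo] --> (0 : R).
Proof.
move=> aC; apply: (@squeeze_cvgr _ _ _ _ (cst 0) (fun N => C * N%:R^-1)).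
- by near=> N; exact: aC.
- exact: cvg_cst.
- rewrite -(mulr0 C); apply: cvgM; first exact: cvg_cst.
  by rewrite -cvg_shiftS; exact: cvg_harmonic.
Unshelve. all: by end_near. Qed.

(** In use [s] is [N ^ (-3/2)], [n] counts edges, [s * D] bounds an entry of the kernel and
    [s * (D * N)] a row sum. The four products then have orders 1, [1 / N], [1 / N ^ 2] and [1 / N];
    the third is also recorded as [1 / N]. *)
Lemma gram_rates (R : realType) (n N : nat) (D s : R) : (n <= N ^ 2)%N -> 0 <= D ->
  s ^+ 2 = N%:R^-1 ^+ 3 ->
  [/\ n%:R * ((s * D) * (s * (D * N%:R))) <= D ^+ 2,
      n%:R * (s * D) ^+ 2 <= D ^+ 2 * N%:R^-1,
      n%:R * ((s * D) * (s * (D * N%:R))) ^+ 2 <= D ^+ 4 * N%:R^-1 &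
      n%:R * ((s * D) * (s * (D * N%:R)) ^+ 3) <= D ^+ 4 * N%:R^-1].
Proof.
move=> nN D0 s2; set y : R := N%:R; set r := N%:R^-1 in s2 *.
have r0 : 0 <= r by rewrite invr_ge0.
have y0 : 0 <= y by [].
have ny : (n%:R : R) <= y ^+ 2 by rewrite /y -natrX ler_nat.
have yr0 : 0 <= y * r by rewrite mulr_ge0.
(* An inequality, because [0^-1 = 0] makes the product 0 at [N = 0]; it lets all [N] be treated
   alike. *)
have yr1 : y * r <= 1.
  rewrite /y /r; have [->|N0] := eqVneq (N%:R : R) 0; first by rewrite mul0r ler01.
  by rewrite divff.
have r1 : r <= 1.
  rewrite /r; case: (N) => [|k]; first by rewrite invr0 ler01.
  by rewrite invf_le1// ler1n.
have bound (c e : R) : 0 <= c -> 0 <= e -> c * n%:R * e <= c * (y ^+ 2 * e).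
  by move=> c0 e0; rewrite -mulrA ler_wpM2l// ler_wpM2r.
have pow k (e : R) : 0 <= e -> e * (y * r) ^+ k <= e.
  by move=> e0; rewrite ler_piMr// exprn_ile1.
split.
- rewrite (_ : _ * _ = D ^+ 2 * n%:R * (y * s ^+ 2)); last by ring.
  rewrite s2.
  apply: le_trans (bound (D ^+ 2) (y * r ^+ 3) _ _) _.
  + exact: sqr_ge0.
  + by rewrite mulr_ge0// exprn_ge0.
  + by rewrite (_ : y ^+ 2 * _ = (y * r) ^+ 3) ?pow ?sqr_ge0//; ring.
- rewrite (_ : _ * _ = D ^+ 2 * n%:R * s ^+ 2); last by ring.
  rewrite s2.
  apply: le_trans (bound (D ^+ 2) (r ^+ 3) _ _) _.
  + exact: sqr_ge0.
  + exact: exprn_ge0.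
  + rewrite (_ : D ^+ 2 * _ = D ^+ 2 * r * (y * r) ^+ 2); last by ring.
    by apply: pow; apply: mulr_ge0 => //; exact: sqr_ge0.
- rewrite (_ : _ * _ = D ^+ 4 * n%:R * (y ^+ 2 * (s ^+ 2) ^+ 2)); last by ring.
  rewrite s2.
  apply: le_trans (bound (D ^+ 4) (y ^+ 2 * (r ^+ 3) ^+ 2) _ _) _.
  + exact: exprn_ge0.
  + by apply: mulr_ge0; exact: sqr_ge0.
  + rewrite (_ : D ^+ 4 * _ = D ^+ 4 * r * r * (y * r) ^+ 4); last by ring.
    have e0 : 0 <= D ^+ 4 * r by rewrite mulr_ge0// exprn_ge0.
    by apply: le_trans (pow _ _ (mulr_ge0 e0 r0)) _; rewrite ler_piMr.
- rewrite (_ : _ * _ = D ^+ 4 * n%:R * (y ^+ 3 * (s ^+ 2) ^+ 2)); last by ring.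
  rewrite s2.
  apply: le_trans (bound (D ^+ 4) (y ^+ 3 * (r ^+ 3) ^+ 2) _ _) _.
  + exact: exprn_ge0.
  + by apply: mulr_ge0; [exact: exprn_ge0|exact: sqr_ge0].
  + rewrite (_ : D ^+ 4 * _ = D ^+ 4 * r * (y * r) ^+ 5); last by ring.
    by apply: pow; rewrite mulr_ge0// exprn_ge0.
Qed.

Theorem theorem7p1 (R : realType) (k : nat) (B : R) (f : R -> R -> R)
  (h : 'I_k -> R -> R)
  (d : nat -> measure_display) (T : forall N, measurableType (d N))
  (P : forall N, probability (T N) R)
  (X : forall N, 'I_N -> 'I_N -> {RV (P N) >-> R})
  (k_ge1 : (1 <= k)%N) (B_gt0 : 0 < B)
  (f_ge0 : forall x y : R, x \in `[0, 1] -> y \in `[0, 1] -> 0 <= f x y)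
  (f_sym : forall x y : R, x \in `[0, 1] -> y \in `[0, 1] -> f x y = f y x)
  (f_bounded : exists M : R, forall x y : R,
     x \in `[0, 1] -> y \in `[0, 1] -> f x y <= M)
  (f_integrable : riemann_integrable2 f)
  (h_bounded : forall i, exists M : R, forall x : R, x \in `[0, 1] -> `|h i x| <= M)
  (h_integrable : forall i, riemann_integrable (h i))
  (h_orthonormal : orthonormal01 h)
  (X_indep : forall N, independent_on (P N)
     [pred p : 'I_N * 'I_N | (p.1 <= p.2)%N] (fun p => X N p.1 p.2))
  (X_mean : forall N (j l : 'I_N), (j <= l)%N -> ('E_(P N)[X N j l] = 0)%E)
  (X_var : forall N (j l : 'I_N), (j <= l)%N ->
     'V_(P N)[X N j l]%E = (f (grid_pt R j) (grid_pt R l))%:E)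
  (X_moment : forall N (j l : 'I_N) (m : nat), (j <= l)%N -> (1 <= m)%N ->
     ('E_(P N)[fun w => (`|X N j l w| ^+ m)%R] <= ((m%:R : R) `^ (B * m%:R))%R%:E)%E) :
  let Q (i : 'I_k) (N : nat) (w : T N) : R :=
    quad_form2 (discr_vec N (h i)) (symm_mx (X N) w) in
  forall i : 'I_k,
    cvg_in_distribution P
      (fun N w => (Q i N w - fine 'E_(P N)[Q i N]%E) / Num.sqrt N%:R)
      (normal_law 0 (sigma2 f (h i))).
Proof.
move=> Q i.
have [M fM] := f_bounded; have [H hH] := h_bounded i.
have zero_in : (0 : R) \in `[0, 1] by rewrite in_itv /= lexx ler01.
have H_ge0 : 0 <= H := le_trans (normr_ge0 _) (hH _ zero_in).
have M_ge0 : 0 <= M := le_trans (f_ge0 _ _ zero_in zero_in) (fM _ _ zero_in zero_in).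
have grid_in N (l : 'I_N) : grid_pt R l \in `[0, 1].
  exact: cell_subset (grid_pt_cell R l).
pose x N (l : 'I_N) := h i (grid_pt R l).
have x_le N l : `|x N l| <= H by apply: hH.
pose XE N (a : edge N) : {RV (P N) >-> R} := X N (val a).1 (val a).2.
pose v N (a : edge N) := f (grid_pt R (val a).1) (grid_pt R (val a).2).
pose b4 : R := 4%:R `^ (B * 4%:R).
have b4_ge0 : 0 <= b4 by exact: powR_ge0.
(* [A >= M] bounds the variances, and [A ^ 2 >= A >= b4] bounds the fourth moments, by [A >= 1];
   [b4] is the moment bound at [m = 4]. *)
pose A := M + b4 + 1.
have A_ge1 : 1 <= A by rewrite /A; lra.
have XE_moments N a : all_moments (P N) (XE N a).
  apply: (@all_moments_expectation _ _ _ _ _ (fun m => (m%:R : R) `^ (B * m%:R))) => m m1.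
  by apply: X_moment => //; exact: (valP a).
have XE_mean N a : \int[P N]_w XE N a w = 0.
  by rewrite mean_expectation X_mean//; exact: (valP a).
have XE_var N a : \int[P N]_w XE N a w ^+ 2 = v N a.
  apply: mean_sqr_variance; first by apply: X_mean; exact: (valP a).
  by apply: X_var; exact: (valP a).
have v_le N a : v N a <= A.
  by apply: le_trans (fM _ _ (grid_in _ _) (grid_in _ _)) _; rewrite /A; lra.
have v_ge0 N a : 0 <= v N a by exact: f_ge0.
have XE_fourth N a : \int[P N]_w XE N a w ^+ 4 <= A ^+ 2.
  apply: (@le_trans _ _ b4); last first.
    by rewrite expr2 (le_trans (y := A))//; [rewrite /A; lra|rewrite ler_peMr//; lra].
  rewrite -lee_fin; apply: le_trans (X_moment N _ _ 4%N (valP a) isT).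
  rewrite unlock /Rintegral fineK; last first.
    by apply: integrable_fin_num => //; apply: all_moments_integrable; moments.
  rewrite le_eqVlt; apply/orP; left; apply/eqP; apply: eq_integral => w _.
  by rewrite -normrX ger0_norm// (exprM _ 2 2) sqr_ge0.
(* The vector [e_i] contributes [N ^ (-1/2)] twice and the normalization once, hence the scale
   [N ^ (-3/2)]. *)
pose s N : R := N%:R^-1 / Num.sqrt N%:R.
have s2 N : s N ^+ 2 = N%:R^-1 ^+ 3.
  by rewrite /s exprMn [(Num.sqrt _)^-1 ^+ 2]exprVn sqr_sqrtr// -exprSr.
have s_ge0 N : 0 <= s N by rewrite /s divr_ge0 ?invr_ge0.
pose K N (a b : edge N) := s N * gram (x N) a b.
pose D := 2 * H ^+ 2.
have D_ge0 : 0 <= D by rewrite mulr_ge0// sqr_ge0.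
have -> : (fun N w => (Q i N w - fine 'E_(P N)[Q i N]%E) / Num.sqrt N%:R) =
    (fun N => qform (XE N) (v N) (K N)).
  (* The type of [w] depends on [N], hence dependent extensionality. *)
  apply: functional_extensionality_dep => N; apply/funext => w.
  have WE w' j l : symm_mx (X N) w' j l = XE N (edge_of j l) w' by rewrite mxE.
  have QE w' : Q i N w' = \sum_j (\sum_l XE N (edge_of j l) w' *
      (x N l / Num.sqrt N%:R)) ^+ 2.
    rewrite /Q quad_form2E; last first.
      by apply/matrixP => j l; rewrite mxE !WE edge_ofC.
    apply: eq_bigr => j _; congr (_ ^+ 2); apply: eq_bigr => l _.
    by rewrite WE mxE.
  have aQ : all_moments (P N) (Q i N).
    by rewrite (funext QE); moments.
  (* The means that [cprod] subtracts, put back. As the form is centred, [EQ] identifies this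
     constant with the normalized mean of the statistic. *)
  pose const := \sum_p K N p.1 p.2 * ((p.1 == p.2)%:R * v N p.1).
  have QqE w' : Q i N w' / Num.sqrt N%:R = qform (XE N) (v N) (K N) w' + const.
    rewrite /qform /const -big_split /=.
    rewrite (eq_bigr (fun p => \sum_j s N * ((coef (x N) j p.1 * XE N p.1 w') *
        (coef (x N) j p.2 * XE N p.2 w')))); last first.
      move=> p _; rewrite -mulrDr /cprod subrK /K /gram mulr_sumr mulr_suml.
      by apply: eq_bigr => j _; ring.
    rewrite exchange_big QE mulr_suml; apply: eq_bigr => j _ /=.
    rewrite -mulr_sumr -(pair_bigA _ (fun a b => (coef (x N) j a * XE N a w') *
      (coef (x N) j b * XE N b w'))) /=.
    rewrite (_ : \sum_a \sum_b _ = (\sum_a coef (x N) j a * XE N a w') ^+ 2); last first.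
      by rewrite expr2 big_distrlr.
    have -> : \sum_a coef (x N) j a * XE N a w' = \sum_l x N l * XE N (edge_of j l) w'.
      rewrite (eq_bigr (fun a => \sum_l (edge_of j l == a)%:R * (x N l * XE N a w'))).
        by rewrite exchange_big; apply: eq_bigr => l _; exact: (sum_edge_of (fun a => x N l * XE N a w')).
      by move=> a _; rewrite /coef mulr_suml; apply: eq_bigr => l _; ring.
    rewrite (eq_bigr (fun l => (Num.sqrt N%:R)^-1 * (x N l * XE N (edge_of j l) w'))); last first.
      by move=> l _; ring.
    rewrite -mulr_sumr exprMn /s [(Num.sqrt _)^-1 ^+ 2]exprVn sqr_sqrtr//.
    by ring.
  have EQ : fine 'E_(P N)[Q i N]%E / Num.sqrt N%:R = const.
    rewrite -mean_expectation mulrC -meanZ//.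
    rewrite (_ : \int[P N]_w' _ = \int[P N]_w' (qform (XE N) (v N) (K N) w' + const)).
      rewrite meanD ?mean_cst ?mean_qform ?add0r//.
      - exact: (independent_on_sig (X_indep N)).
      - exact: all_moments_qform.
      - exact: all_moments_cst.
    by apply: eq_Rintegral => w' _; rewrite mulrC QqE.
  by rewrite mulrBl EQ QqE addrK.
have rates N := gram_rates (card_edge_le N) D_ge0 (s2 N).
apply: (@quadratic_clt _ _ _ _ _ _ _ A _ _ _ _ _ _ K
   (fun N => s N * D) (fun N => s N * (D * N%:R)) _ _ _ _ _ (D ^+ 2)) => //.
- by move=> N; exact: (independent_on_sig (X_indep N)).
- by move=> N a b; rewrite /K gramC.
- by move=> N; rewrite mulr_ge0.
- by move=> N; rewrite !mulr_ge0.
- by move=> N a b; rewrite normrM ger0_norm// ler_wpM2l// norm_gram_le.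
- move=> N a; rewrite (eq_bigr (fun b => s N * `|gram (x N) a b|)) => [|b _].
    by rewrite -mulr_sumr ler_wpM2l// sum_norm_gram_le.
  by rewrite normrM ger0_norm.
- apply: mulr_ge0 => //; apply: Rintegral_ge0 => p [[p1 p2] p3].
  apply: mulr_ge0; last exact: sqr_ge0.
  apply: mulr_ge0; last exact: f_ge0.
  by apply: mulr_ge0; [exact: sqr_ge0|exact: f_ge0].
- by move=> N; have [] := rates N.
- apply: (@cvg0_le_inv _ _ (D ^+ 2)) => N; have [_ -> _ _] := rates N.
  by rewrite andbT mulr_ge0// sqr_ge0.
- apply: (@cvg0_le_inv _ _ (D ^+ 4)) => N; have [_ _ -> _] := rates N.
  by rewrite andbT mulr_ge0// sqr_ge0.
- apply: (@cvg0_le_inv _ _ (D ^+ 4)) => N; have [_ _ _ ->] := rates N.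
  by rewrite andbT !mulr_ge0// exprn_ge0// !mulr_ge0.
- have var_le N a : v N a <= M by apply: fM; exact: grid_in.
  (* [grid_sum n] lives on the grid with [n.+1] points per axis, hence the shift. *)
  rewrite -cvg_shiftS /= /sigma2; apply: cvgM; first exact: cvg_cst.
  (* The contribution of pairs of distinct vertices; the pairs [j = j'] give [grid_sum] exactly. *)
  pose r n := s n.+1 ^+ 2 * \sum_j \sum_(j' | j' != j) overlap (x n.+1) (v n.+1) j j' ^+ 2.
  rewrite (_ : (fun n => _) = fun n => grid_sum f (h i) n + r n); last first.
    apply/funext => n /=.
    rewrite (eq_bigr (fun p => s n.+1 ^+ 2 * (gram (x n.+1) p.1 p.2 ^+ 2 *
      (v n.+1 p.1 * v n.+1 p.2)))); last by move=> p _; rewrite /K; ring.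
    rewrite -mulr_sumr sum_gram_sqr.
    rewrite (eq_bigr (fun j => overlap (x n.+1) (v n.+1) j j ^+ 2 +
      \sum_(j' | j' != j) overlap (x n.+1) (v n.+1) j j' ^+ 2)); last first.
      by move=> j _; rewrite (bigD1 j).
    rewrite big_split mulrDr; congr (_ + _); rewrite /grid_sum s2 /=.
    rewrite -(pair_bigA _ (fun (q : 'I_n.+1 * 'I_n.+1) (l' : 'I_n.+1) =>
      kernel3 f (h i) (grid_pt R q.1, grid_pt R q.2, grid_pt R l') * n.+1%:R^-1 ^+ 3)) /=.
    rewrite -(pair_bigA _ (fun (l j : 'I_n.+1) => \sum_l'
      kernel3 f (h i) (grid_pt R l, grid_pt R j, grid_pt R l') * n.+1%:R^-1 ^+ 3)) /=.
    (* The common vertex [j] of the two edges is the middle variable of [kernel3], so it is made the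
       outer index. *)
    rewrite exchange_big mulr_sumr; apply: eq_bigr => j _ /=.
    rewrite overlap_diag expr2 big_distrlr mulr_sumr; apply: eq_bigr => l _ /=.
    rewrite mulr_sumr; apply: eq_bigr => l' _.
    have vE t : v n.+1 (edge_of j t) = f (grid_pt R j) (grid_pt R t).
      by rewrite /v /=; case: (leP j t) => _ //; exact: f_sym.
    by rewrite !vE /kernel3 /= (f_sym (grid_pt R l))// /x; ring.
  rewrite -[X in _ --> X]addr0; apply: (cvgD (grid_sum_cvg f_ge0 fM f_integrable hH (h_integrable i)) _).
  apply: (cvg0_le_addl (a := r)) => e e0.
  exists (fun n => (H ^+ 2 * M) ^+ 2 * n.+1%:R^-1).
    rewrite -[X in _ --> X](mulr0 ((H ^+ 2 * M) ^+ 2)).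
    by apply: cvgM; [exact: cvg_cst|exact: cvg_harmonic].
  move=> n; rewrite ger0_norm; last first.
    apply: mulr_ge0; first exact: sqr_ge0.
    by do 2 (apply: sumr_ge0 => ? _); exact: sqr_ge0.
  apply: (@le_trans _ _ ((H ^+ 2 * M) ^+ 2 * n.+1%:R^-1)); last by rewrite lerDr ltW.
  rewrite /r s2.
  (* With [N = n.+1]: at most [N ^ 2] pairs of bounded size, against the factor [N ^ (-3)]. *)
  apply: (@le_trans _ _ (n.+1%:R^-1 ^+ 3 * \sum_(j < n.+1) \sum_(j' < n.+1) (H ^+ 2 * M) ^+ 2)).
    rewrite ler_wpM2l ?exprn_ge0 ?invr_ge0//; apply: ler_sum => j _.
    rewrite big_mkcond; apply: ler_sum => j' _; case: ifPn => [j'j|_]; last exact: sqr_ge0.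
    have ov := norm_overlap_le (x_le n.+1) (v_ge0 n.+1) (var_le n.+1) (j := j) (j' := j').
    rewrite -(real_normK (num_real (overlap _ _ _ _))) lerXn2r ?nnegrE//.
      by rewrite mulr_ge0// sqr_ge0.
    by apply: ov; rewrite eq_sym.
  rewrite !sumr_const !card_ord -mulrnA -[_ *+ (_ * _)]mulr_natr natrM.
  by rewrite le_eqVlt; apply/orP; left; apply/eqP; field; rewrite ?pnatr_eq0.
Qed.
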